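(* Let $\mu$ be a self-similar measure on $\mathbb{R}^d$ (with $R^{-1}=\lambda O$, $0<\lambda<1$, $O$ orthogonal) which is absolutely continuous with respect to Lebesgue measure restricted to its attractor $X$. If $\mu$ admits a frame measure, then $p_\tau\le\lambda^{dk}$ for all $k\in\mathbb{N}$ and all $\tau\in\mathcal{A}_k$. If moreover the fixed point condition holds for some $k\in\mathbb{N}$ and $\tau\in\mathcal{A}_k$, then for this $k$ and $\tau$, $p_\tau=\lambda^{dk}$.
   Context: IFS $\tau_{b_i}(x)=R^{-1}(x+b_i)$, $i=1,\dots,N$, $b_i\in\mathbb{R}^d$, weights $p_{b_i}>0$ summing to $1$; attractor $X=\bigcup_i\tau_{b_i}(X)$; invariant (self-similar) measure $\mu=\sum_ip_{b_i}\mu\circ\tau_{b_i}^{-1}$. For $I=i_1\cdots i_n$, $\tau_I=\tau_{b_{i_1}}\circ\cdots\circ\tau_{b_{i_n}}$, $p_I=\prod_j p_{b_{i_j}}$; $\mathcal{A}_n$ is the set of distinct maps among $\{\tau_I: |I|=n\}$, and $p_\tau=\sum\{p_I:\tau_I=\tau\}$. Fixed point condition for $k$ and $\tau\in\mathcal{A}_k$: the fixed point $x_\tau$ of $\tau$ does not lie in $\tilde\tau(X)$ for any $\tilde\tau\in\mathcal{A}_k$, $\tilde\tau\ne\tau$. A frame measure for $\mu$ is a Borel measure $\nu$ with $A\|f\|_{L^2(\mu)}^2\le\|\widehat{f\,d\mu}\|_{L^2(\nu)}^2\le B\|f\|_{L^2(\mu)}^2$ for all $f\in L^2(\mu)$,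 some $A,B>0$, where $\widehat{f\,d\mu}(t)=\int f(x)e^{-2\pi it\cdot x}d\mu(x)$. *)

(* Defs.v *)
From HB Require Import structures.
From mathcomp Require Import all_boot all_order all_algebra.
From mathcomp Require Import all_classical all_reals all_analysis.
Set Implicit Arguments. Unset Strict Implicit. Unset Printing Implicit Defensive.
Import Order.TTheory GRing.Theory Num.Theory.
Import numFieldNormedType.Exports.
Local Open Scope classical_set_scope.
Local Open Scope ring_scope.

Definition Rd (R : realType) (d : nat) :=
  g_sigma_algebraType (@open 'cV[R]_d).

Definition box (R : realType) (d : nat) (a b : 'cV[R]_d) : set 'cV[R]_d :=
  [set x | forall i : 'I_d, a i 0 <= x i 0 <= b i 0].
Definition box_vol (R : realType) (d : nat) (a b : 'cV[R]_d) : R :=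
  \prod_(i < d) (b i 0 - a i 0).

Definition leb_null (R : realType) (d : nat) (A : set 'cV[R]_d) : Prop :=
  forall eps : R, 0 < eps ->
  exists a b : nat -> 'cV[R]_d,
    (forall n (i : 'I_d), a n i 0 <= b n i 0) /\
    (A `<=` \bigcup_n box (a n) (b n)) /\
    (forall N, \sum_(n < N) box_vol (a n) (b n) <= eps).

Definition tau (R : realType) (d : nat) (lam : R) (O : 'M[R]_d)
  (b : 'cV[R]_d) (x : 'cV[R]_d) : 'cV[R]_d := lam *: (O *m (x + b)).

Definition tau_word (R : realType) (d N k : nat) (lam : R) (O : 'M[R]_d)
  (b : 'I_N -> 'cV[R]_d) (I : {ffun 'I_k -> 'I_N}) : 'cV[R]_d -> 'cV[R]_d :=
  foldr (fun j f => tau lam O (b (I j)) \o f) id (enum 'I_k).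

Definition p_word (R : realType) (N k : nat) (p : 'I_N -> R)
  (I : {ffun 'I_k -> 'I_N}) : R := \prod_(j < k) p (I j).

(* For tau = tau_I in A_k: p_tau = sum of p_J over words J of length k with
   tau_J = tau (equality of maps). *)
Definition p_tau (R : realType) (d N k : nat) (lam : R) (O : 'M[R]_d)
  (b : 'I_N -> 'cV[R]_d) (p : 'I_N -> R) (I : {ffun 'I_k -> 'I_N}) : R :=
  \sum_(J : {ffun 'I_k -> 'I_N} | `[< tau_word lam O b J = tau_word lam O b I >])
     p_word p J.

Definition fixed_point_condition (R : realType) (d N k : nat) (lam : R)
  (O : 'M[R]_d) (b : 'I_N -> 'cV[R]_d) (X : set 'cV[R]_d)
  (I : {ffun 'I_k -> 'I_N}) : Prop :=
  forall x : 'cV[R]_d, tau_word lam O b I x = x ->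
  forall J : {ffun 'I_k -> 'I_N}, tau_word lam O b J <> tau_word lam O b I ->
    ~ ((tau_word lam O b J) @` X) x.

Definition dotv (R : realType) (d : nat) (t x : 'cV[R]_d) : R :=
  \sum_(i < d) t i 0 * x i 0.

(* For a complex-valued f = u + i v, the Fourier transform
   hat(f dmu)(t) = int f(x) e^{-2 pi i t.x} dmu(x), split into real and
   imaginary parts. *)
Definition ft_re (R : realType) (d : nat) (mu : {measure set Rd R d -> \bar R})
  (u v : 'cV[R]_d -> R) (t : 'cV[R]_d) : R :=
  Rintegral mu setT (fun x : Rd R d =>
    u x * cos (2 * pi * dotv t x) + v x * sin (2 * pi * dotv t x)).
Definition ft_im (R : realType) (d : nat) (mu : {measure set Rd R d -> \bar R})
  (u v : 'cV[R]_d -> R) (t : 'cV[R]_d) : R :=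
  Rintegral mu setT (fun x : Rd R d =>
    v x * cos (2 * pi * dotv t x) - u x * sin (2 * pi * dotv t x)).

Definition L2norm2 (R : realType) (d : nat) (mu : {measure set Rd R d -> \bar R})
  (u v : 'cV[R]_d -> R) : \bar R :=
  (\int[mu]_(x in [set: Rd R d]) ((u x) ^+ 2 + (v x) ^+ 2)%:E)%E.

Definition inL2 (R : realType) (d : nat) (mu : {measure set Rd R d -> \bar R})
  (u v : 'cV[R]_d -> R) : Prop :=
  measurable_fun [set: Rd R d] (u : Rd R d -> R) /\
  measurable_fun [set: Rd R d] (v : Rd R d -> R) /\
  (L2norm2 mu u v < +oo)%E.

Definition frame_measure (R : realType) (d : nat)
  (mu nu : {measure set Rd R d -> \bar R}) : Prop :=
  exists A B : R, 0 < A /\ 0 < B /\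
  forall u v : 'cV[R]_d -> R, inL2 mu u v ->
    let F := (\int[nu]_(t in [set: Rd R d])
                ((ft_re mu u v t) ^+ 2 + (ft_im mu u v t) ^+ 2)%:E)%E in
    (A%:E * L2norm2 mu u v <= F)%E /\ (F <= B%:E * L2norm2 mu u v)%E.

(* Main.v *)
(* Let phi be the density of mu with respect to Lebesgue measure L.  If G and
   H = G + t are such that phi > 0 on both, then 1_G / phi and 1_H / phi have,
   with respect to mu, Fourier transforms differing by a phase, so the frame
   inequalities compare their norms in L^2(mu), i.e. the integrals of 1 / phi
   over G and H.  By a Steinhaus argument any two sets of positive measure
   contain such G and H; hence on {phi > 0} the density lies between two
   positive constants m and M.
   For tau = tau_I of ratio s = lam^k, invariance gives
   p_tau^n mu(Q) <= mu(tau^n(Q)) <= M L(tau^n(Q)) <= C s^(dn) for a box Q, and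
   n -> oo yields p_tau <= s^d.  Under the fixed point condition only tau
   reaches a small ball B around its fixed point, so mu(tau^n(A)) =
   p_tau^n mu(A) for A inside B, and the lower bound m on the density gives
   the reverse inequality. *)
Require Import Defs.
From HB Require Import structures.
From mathcomp Require Import all_boot all_order all_algebra.
From mathcomp Require Import all_classical all_reals all_analysis.
From mathcomp Require Import measurable_realfun ring lra.
Set Implicit Arguments. Unset Strict Implicit. Unset Printing Implicit Defensive.
Import Order.TTheory GRing.Theory Num.Theory.
Import numFieldNormedType.Exports.
Local Open Scope classical_set_scope.
Local Open Scope ring_scope.

(** * Borel sets of R^d *)

(** The frame bounds compare two functions only when their transforms have equal modulus. Dividing
    by the density [phi] achieves this: the [mu]-transform of [1_G / phi] is the Lebesgue transform
    of [1_G], for which a translation is a mere phase. These quotients must lie in L^2 of [mu], so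
    they are used only on sets where [phi] is bounded below. Since [phi] may vanish on a set of
    positive volume, its lower bound is stated inside a set [S] of full [mu]-measure, and the second
    half of the theorem has to work around the complement of [S]. The effect of a similarity of
    ratio [s] on volume is needed only up to a constant depending on the dimension: the comparison
    runs over all iterates, and a factor independent of the iterate disappears in the limit.
    Lebesgue measure is therefore built directly from coverings by boxes, and the rough factor
    [(2 s d)^d] does the work of the exact [s^d]. *)

Lemma open_measurable_Rd (R : realType) (d : nat) (U : set 'cV[R]_d) :
  open U -> measurable (U : set (Rd R d)).
Proof. by move=> oU; exact: sub_sigma_algebra. Qed.

Lemma closed_measurable_Rd (R : realType) (d : nat) (U : set 'cV[R]_d) :
  closed U -> measurable (U : set (Rd R d)).
Proof.
move=> /closed_openC/open_measurable_Rd/measurableC; by rewrite setCK.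
Qed.

Lemma continuous_measurable_Rd (R : realType) (d : nat) (f : 'cV[R]_d -> R) :
  continuous f -> measurable_fun setT (f : Rd R d -> R).
Proof.
move=> /continuousP cf; apply: (measurability _ (RGenOpens.measurableE R)).
move=> _ [_ [a [b ->] <-]]; rewrite setTI.
by apply: open_measurable_Rd; apply: cf; exact: interval_open.
Qed.

Lemma measurable_coord (R : realType) (d : nat) (i : 'I_d) :
  measurable_fun setT (fun x : Rd R d => (x : 'cV[R]_d) i 0).
Proof. by apply: continuous_measurable_Rd; exact: coord_continuous. Qed.

(** Every point of [U] lies in a cube with rational centre and radius [1/(n+1)] inside [U]. The
    inclusion is put into the member, not into the index set, so that the union runs over a whole
    countable type. *)
Lemma open_bigcup_rat_box (R : realType) (d : nat) (U : set 'cV[R]_d) :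
  let B (qn : 'cV[rat]_d * nat) :=
    [set x : 'cV[R]_d | forall i, `|x i 0 - ratr (qn.1 i 0)| <= qn.2.+1%:R^-1] in
  open U ->
  U = \bigcup_(qn in [set: 'cV[rat]_d * nat]) [set x | B qn x /\ B qn `<=` U].
Proof.
move=> B oU; apply/seteqP; split=> [x Ux|x [qn _ [Bx]]]; last by apply.
have /nbhs_ballP[e /= e0 xeU] : nbhs x U by exact: open_nbhs_nbhs.
have [n] := ltr_add_invr (y := 0) (x := e / 2) ltac:(by rewrite divr_gt0).
rewrite add0r => ne.
have /choice[q qP] (i : 'I_d) :
    exists q : rat, `|x i 0 - ratr q| < n.+1%:R^-1.
  have /rat_in_itvoo[q] : x i 0 - n.+1%:R^-1 < x i 0 + n.+1%:R^-1.
    by rewrite ltrD2l (@lt_trans _ _ 0) // ?oppr_lt0 invr_gt0.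
  by rewrite in_itv /= => h; exists q; rewrite ltr_distlC.
exists (\col_i q i, n) => //; split=> [i|y By]; first by rewrite /= mxE ltW.
apply: xeU; split=> // i j; rewrite (ord1 j).
have := By i; have := qP i; rewrite /= mxE /ball /= => h1 h2.
have -> : x i 0 - y i 0 = (x i 0 - ratr (q i)) - (y i 0 - ratr (q i)) by ring.
rewrite (le_lt_trans (ler_normB _ _)) // (splitr e).
by rewrite (lt_le_trans (ltr_leD h1 h2)) // lerD // ltW.
Qed.

(** Open sets generate the Borel structure and are countable unions of cubes; a cube is a finite
    intersection of conditions on coordinates. *)
Lemma measurable_fun_Rd (R : realType) (d : nat) disp (T : measurableType disp)
    (f : T -> Rd R d) :
  (forall i, measurable_fun setT (fun x => (f x : 'cV[R]_d) i 0)) ->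
  measurable_fun setT f.
Proof.
move=> mf; apply: (@measurability _ _ T (Rd R d) setT f (@open 'cV[R]_d)) => //.
move=> _ [U oU <-]; rewrite setTI (open_bigcup_rat_box oU) preimage_bigcup.
apply: countable_bigcupT_measurable => [|[q n] /=]; first exact: countableP.
set B := [set x0 : 'cV[R]_d | forall i, `|x0 i 0 - ratr (q i 0)| <= n.+1%:R^-1].
have [BU|BU] := pselect (B `<=` U); last first.
  by rewrite (_ : _ @^-1` _ = set0) // -subset0 => x [_ /BU].
rewrite (_ : _ @^-1` _ = \bigcap_(i in [set: 'I_d])
    ((fun x => (f x : 'cV[R]_d) i 0) @^-1`
      `[ratr (q i 0) - n.+1%:R^-1, ratr (q i 0) + n.+1%:R^-1])).
  apply: fin_bigcap_measurable; first exact: finite_finset.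
  by move=> i _; rewrite -[X in measurable X]setTI; apply: mf.
apply/seteqP; split=> x /=.
  by move=> [xB _] i _ /=; rewrite in_itv /= -ler_distl; exact: xB.
move=> xB; split=> // i.
by have := xB i Logic.I; rewrite /= in_itv /= -ler_distl.
Qed.

Lemma measurable_affine (R : realType) (d : nat) (M : 'M[R]_d) (c : 'cV[R]_d) :
  measurable_fun setT ((fun x : 'cV[R]_d => M *m x + c) : Rd R d -> Rd R d).
Proof.
apply: measurable_fun_Rd => i.
rewrite (_ : (fun _ => _) =
   (fun x : Rd R d => (\sum_(j < d) M i j * (x : 'cV[R]_d) j 0) + c i 0)).
  apply: measurable_funD => //; apply: measurable_sum => j.
  by apply: measurable_funM => //; exact: measurable_coord.
by apply/funext => x; rewrite !mxE.
Qed.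

Lemma closed_box (R : realType) (d : nat) (a b : 'cV[R]_d) : closed (box a b).
Proof.
rewrite (_ : box a b = \bigcap_(i in [set: 'I_d])
   ((fun x : 'cV[R]_d => x i 0) @^-1` `[a i 0, b i 0])).
  apply: closed_bigI => i _.
  apply: closed_comp => [x _|]; last exact: interval_closed.
  exact: coord_continuous.
apply/seteqP; split=> x h i => [_|]; first by rewrite /= in_itv /=; exact: h.
by have := h i Logic.I; rewrite /= in_itv.
Qed.

(** * Lebesgue measure *)

Lemma box_vol_ge0 (R : realType) (d : nat) (a b : 'cV[R]_d) :
  (forall i, a i 0 <= b i 0) -> 0 <= box_vol a b.
Proof. by move=> ab; apply: prodr_ge0 => i _; rewrite subr_ge0. Qed.

(** The value is [+oo] on a set contained in no box. [mu_ext] takes infima over covers by Borel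
    sets; as each is priced by its cheapest enclosing box, this amounts to covers by boxes and gives
    Lebesgue outer measure. *)
Definition box_gauge (R : realType) (d : nat) (A : set (Rd R d)) : \bar R :=
  ereal_inf [set (box_vol ab.1 ab.2)%:E |
    ab in [set ab : 'cV[R]_d * 'cV[R]_d |
      (forall i, ab.1 i 0 <= ab.2 i 0) /\ A `<=` box ab.1 ab.2]].

Lemma box_gauge_ge0 (R : realType) (d : nat) (A : set (Rd R d)) :
  (0 <= box_gauge A)%E.
Proof.
by apply: le_ereal_inf_tmp => _ [ab [? _] <-]; rewrite lee_fin box_vol_ge0.
Qed.

Lemma box_gauge_box (R : realType) (d : nat) (a b : 'cV[R]_d) :
  (forall i, a i 0 <= b i 0) -> (box_gauge (box a b) <= (box_vol a b)%:E)%E.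
Proof. by move=> ab; apply: ereal_inf_lbound; exists (a, b) => //; split. Qed.

(** In dimension 0 every box has volume 1, an empty product, and this fails; hence the dimension
    [n.+1] wherever [leb] occurs. *)
Lemma box_gauge0 (R : realType) (n : nat) : box_gauge (set0 : set (Rd R n.+1)) = 0.
Proof.
apply/eqP; rewrite eq_le box_gauge_ge0 andbT; apply: ereal_inf_lbound.
exists (0, 0) => /=; first by split=> [i|x []]; rewrite lexx.
by rewrite /box_vol (bigD1 ord0) //= !mxE subr0 mul0r.
Qed.

Definition leb_outer (R : realType) (n : nat) : set 'cV[R]_n.+1 -> \bar R :=
  mu_ext (@box_gauge R n.+1).

HB.instance Definition _ (R : realType) (n : nat) :=
  isOuterMeasure.Build R 'cV[R]_n.+1 (@leb_outer R n)
    (mu_ext0 (@box_gauge0 R n) (@box_gauge_ge0 R n.+1))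
    (mu_ext_ge0 (@box_gauge_ge0 R n.+1))
    (@le_mu_ext _ _ _ (@box_gauge R n.+1))
    (mu_ext_sigma_subadditive (@box_gauge_ge0 R n.+1)).

Lemma leb_outer_box (R : realType) (n : nat) (a b : 'cV[R]_n.+1) :
  (forall i, a i 0 <= b i 0) -> (leb_outer (box a b) <= (box_vol a b)%:E)%E.
Proof.
move=> ab; apply: le_trans (box_gauge_box ab).
apply: ereal_inf_lbound; exists (fun k => if k == 0%N then box a b : set (Rd R n.+1) else set0).
  split=> [[|k]|x abx]; last by exists 0%N.
  - exact: (@closed_measurable_Rd R n.+1 _ (@closed_box R n.+1 a b)).
  - exact: measurable0.
rewrite nneseries_recl //; last by move=> k _; exact: (@box_gauge_ge0 R n.+1).
rewrite eseries0 ?adde0 // => -[//|k] _ _; exact: (@box_gauge0 R n).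
Qed.

(** The strict inequality leaves a slack [e]; spending [e / 2^(k+1)] on the k-th set trades each
    Borel piece for a box almost as cheap as its gauge. *)
Lemma leb_outer_cover (R : realType) (n : nat) (A : set 'cV[R]_n.+1) (c : R) :
  (leb_outer A < c%:E)%E ->
  exists a b : nat -> 'cV[R]_n.+1,
    [/\ forall k i, a k i 0 <= b k i 0,
        A `<=` \bigcup_k box (a k) (b k) &
        (\sum_(k <oo) (box_vol (a k) (b k))%:E <= c%:E)%E].
Proof.
move=> /ereal_inf_lt[_ [F [mF AF] <-] Fc].
have sF0 : (0 <= \sum_(k <oo) box_gauge (F k))%E.
  by apply: nneseries_ge0 => *; exact: box_gauge_ge0.
have sFfin : (\sum_(k <oo) box_gauge (F k))%E \is a fin_num.
  by rewrite ge0_fin_numE // (lt_trans Fc) ?ltry.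
pose e := c - fine (\sum_(k <oo) box_gauge (F k))%E.
have e0 : 0 < e by rewrite subr_gt0 -lte_fin fineK.
have Ffin k : box_gauge (F k) \is a fin_num.
  rewrite ge0_fin_numE ?box_gauge_ge0 // (le_lt_trans _ (lt_trans Fc (ltry _))) //.
  rewrite (nneseriesD1 (n := k)) //; last by move=> *; exact: box_gauge_ge0.
  by rewrite leeDl // nneseries_ge0 // => *; exact: box_gauge_ge0.
have /choice[ab abP] k : exists ab : 'cV[R]_n.+1 * 'cV[R]_n.+1,
    [/\ forall i, ab.1 i 0 <= ab.2 i 0, F k `<=` box ab.1 ab.2 &
    ((box_vol ab.1 ab.2)%:E <= box_gauge (F k) + (e / (2 ^ k.+1)%:R)%:E)%E].
  have ek0 : 0 < e / (2 ^ k.+1)%:R by rewrite divr_gt0 // ltr0n expn_gt0.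
  have [_ [ab [? ?] <-] /ltW h] := lb_ereal_inf_adherent ek0 (Ffin k).
  by exists ab.
exists (fun k => (ab k).1), (fun k => (ab k).2); split.
- by move=> k; have [] := abP k.
- by move=> x /AF[k _ Fkx]; exists k => //; have [_ + _] := abP k; exact.
apply: (@le_trans _ _ (\sum_(k <oo) (box_gauge (F k) + (e / (2 ^ k.+1)%:R)%:E))%E).
  apply: lee_nneseries => [k _ _|k _]; last by have [] := abP k.
  by rewrite lee_fin box_vol_ge0 //; have [] := abP k.
apply: (le_trans (epsilon_trick _ _ (ltW e0))); first by move=> ?; exact: box_gauge_ge0.
by rewrite -[X in (X + _)%E](fineK sFfin) -EFinD lee_fin /e addrC subrK.
Qed.

(** * Borel sets are Caratheodory-measurable *)

Definition upd (R : realType) (d : nat) (a : 'cV[R]_d) (i : 'I_d) (c : R) :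
  'cV[R]_d := \col_j (if j == i then c else a j 0).

Lemma leb_outer_le_cover (R : realType) (n : nat) (A : set 'cV[R]_n.+1)
    (a b : nat -> 'cV[R]_n.+1) :
  (forall k i, a k i 0 <= b k i 0) -> A `<=` \bigcup_k box (a k) (b k) ->
  (leb_outer A <= \sum_(k <oo) (box_vol (a k) (b k))%:E)%E.
Proof.
move=> ab Aab; apply: (le_trans (le_outer_measure (@leb_outer R n) _ _ Aab)).
apply: (le_trans (outer_measure_sigma_subadditive (@leb_outer R n) _)).
apply: lee_nneseries => [k _ _|k _]; first exact: outer_measure_ge0.
by apply: leb_outer_box.
Qed.

(** A hyperplane orthogonal to an axis cuts each box of a near-optimal cover into two boxes whose
    volumes add up exactly. *)
Lemma caratheodory_halfspace (R : realType) (n : nat) (i : 'I_n.+1) (c : R) :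
  (@leb_outer R n).-caratheodory [set x | x i 0 < c].
Proof.
apply: le_caratheodory_measurable => A; set H := [set _ | _].
change (leb_outer (A `&` H) + leb_outer (A `&` ~` H) <= leb_outer A)%E.
have [Aoo|] := eqVneq (leb_outer A) +oo%E; first by rewrite Aoo leey.
rewrite -ltey => Aoo; apply/lee_addgt0Pr => e e0.
have Afin : leb_outer A \is a fin_num by rewrite ge0_fin_numE //; exact: outer_measure_ge0.
have [|a [b [ab Aab sab]]] := @leb_outer_cover R n A (fine (leb_outer A) + e).
  by rewrite EFinD fineK // lteDl // lte_fin.
rewrite -(fineK Afin) -EFinD; apply: le_trans sab.
(* This is [c] clamped to the i-th side: a box missed by the hyperplane gets one degenerate half of
   volume 0. *)
pose m k := Num.min (b k i 0) (Num.max (a k i 0) c).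
have amb k : a k i 0 <= m k <= b k i 0.
  by rewrite le_min ge_min ab lexx le_max lexx.
have volE k : box_vol (a k) (b k) =
    box_vol (a k) (upd (b k) i (m k)) + box_vol (upd (a k) i (m k)) (b k).
  rewrite /box_vol (bigD1 i) //= [X in _ = X + _](bigD1 i) //=.
  rewrite [X in _ = _ + X](bigD1 i) //= !mxE eqxx.
  rewrite [X in _ = _ * X + _](eq_bigr (fun j => b k j 0 - a k j 0)); last first.
    by move=> j /negbTE ji; rewrite mxE ji.
  rewrite [X in _ = _ + _ * X](eq_bigr (fun j => b k j 0 - a k j 0)); last first.
    by move=> j /negbTE ji; rewrite mxE ji.
  by ring.
have h1 k j : a k j 0 <= upd (b k) i (m k) j 0.
  by rewrite mxE; case: eqP => // ->; case/andP: (amb k).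
have h2 k j : upd (a k) i (m k) j 0 <= b k j 0.
  by rewrite mxE; case: eqP => // ->; case/andP: (amb k).
under eq_eseriesr do rewrite volE EFinD.
rewrite nneseriesD; [|by move=> k _ _; rewrite lee_fin box_vol_ge0..].
apply: leeD; apply: leb_outer_le_cover => //.
- move=> x [Ax /= xc]; have [k _ xk] := Aab _ Ax; exists k => // j.
  have /andP[axj xbj] := xk j; rewrite axj mxE /=; case: eqP => // ji.
  by rewrite le_min -ji xbj le_max ji (ltW xc) orbT.
- move=> x [Ax /= /negP]; rewrite -leNgt => xc.
  have [k _ xk] := Aab _ Ax; exists k => // j.
  have /andP[axj xbj] := xk j; rewrite xbj andbT mxE; case: eqP => // ji.
  by rewrite ge_min ge_max -ji axj ji xc orbT.
Qed.

(** Measurability of the identity into [Rd] says that Borel sets are Caratheodory-measurable; the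
    coordinate criterion leaves only half-spaces to check. *)
Lemma measurable_id_caratheodory (R : realType) (n : nat) :
  measurable_fun setT
    (id : caratheodory_type (@leb_outer R n) -> Rd R n.+1).
Proof.
apply: measurable_fun_Rd => i.
apply: (measurability _ (RGenInftyO.measurableE R)).
move=> _ [_ [c ->] <-]; rewrite setTI.
rewrite (_ : _ @^-1` _ = [set x : 'cV[R]_n.+1 | x i 0 < c]).
  exact: caratheodory_halfspace.
by apply/seteqP; split=> x /=; rewrite in_itv.
Qed.

Lemma measurable_caratheodory (R : realType) (n : nat) (A : set (Rd R n.+1)) :
  measurable A -> (@leb_outer R n).-caratheodory A.
Proof.
move=> mA; have := @measurable_id_caratheodory R n measurableT A mA.
by rewrite setTI.
Qed.

(** The outer measure retyped to carry a Borel measure structure. It stays defined on all sets, so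
    covering estimates apply to it unchanged. *)
Definition leb (R : realType) (n : nat) : set (Rd R n.+1) -> \bar R :=
  @leb_outer R n.

Lemma leb_semi_sigma_additive (R : realType) (n : nat) :
  semi_sigma_additive (@leb R n).
Proof.
move=> F mF tF mUF.
apply: (@caratheodory_measure_sigma_additive R _ (@leb_outer R n)) => //.
  by move=> k; exact: measurable_caratheodory.
exact: measurable_caratheodory.
Qed.

HB.instance Definition _ (R : realType) (n : nat) :=
  isMeasure.Build _ (Rd R n.+1) R (@leb R n)
    (outer_measure0 (@leb_outer R n)) (outer_measure_ge0 (@leb_outer R n))
    (@leb_semi_sigma_additive R n).

Lemma leb_box_lty (R : realType) (n : nat) (a b : 'cV[R]_n.+1) :
  (leb (box a b) < +oo)%E.
Proof.
have [ab|/existsNP[i /negP abi]] := pselect (forall i, a i 0 <= b i 0).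
  exact: le_lt_trans (leb_outer_box ab) (ltry _).
rewrite (_ : box a b = set0) ?measure0 // -subset0 => x /(_ i) /andP[h1 h2].
by rewrite (le_trans h1 h2) in abi.
Qed.

Lemma bigcup_box (R : realType) (d : nat) :
  \bigcup_k box (const_mx (- k%:R)) (const_mx k%:R) = [set: 'cV[R]_d].
Proof.
apply/seteqP; split=> // x _.
exists (Num.truncn (\sum_i `|x i 0|)).+1 => // i; rewrite !mxE -ler_norml.
apply: le_trans (ltW (truncnS_gt _)).
by rewrite (bigD1 i) //= lerDl sumr_ge0.
Qed.

(** Required by Tonelli's theorem and by the Radon-Nikodym derivative. *)
Lemma leb_sigma_finite (R : realType) (n : nat) : sigma_finite setT (@leb R n).
Proof.
exists (fun k => box (const_mx (- k%:R)) (const_mx k%:R)); first by rewrite bigcup_box.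
by move=> k; split; [exact: (@closed_measurable_Rd R n.+1 _ (@closed_box R n.+1 _ _))|exact: leb_box_lty].
Qed.

HB.instance Definition _ (R : realType) (n : nat) :=
  Measure_isSigmaFinite.Build _ (Rd R n.+1) R (@leb R n) (@leb_sigma_finite R n).

(** Links null sets in covering form, in which absolute continuity is assumed, with domination by
    [leb]. *)
Lemma leb_null_leb0 (R : realType) (n : nat) (A : set 'cV[R]_n.+1) :
  leb A = 0 -> leb_null A.
Proof.
move=> A0 e e0; have [|a [b [ab Aab sab]]] := @leb_outer_cover R n A e.
  by rewrite [X in (X < _)%E]A0 lte_fin.
exists a, b; split=> //; split=> // N.
rewrite -lee_fin -sumEFin; apply: le_trans sab.
rewrite -(big_mkord xpredT (fun k => (box_vol (a k) (b k))%:E)).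
by apply: nneseries_lim_ge => k _ _; rewrite lee_fin box_vol_ge0.
Qed.

(** * Similarities *)

(** The Euclidean square: the norm of the matrix type is the largest entry, which orthogonal
    matrices do not preserve. *)
Definition normsq (R : realType) (d : nat) (x : 'cV[R]_d) : R :=
  \sum_i (x i 0) ^+ 2.

(** Given by a matrix rather than by distances, so that inverses (through [U^T]) and measurability
    are matrix computations. *)
Definition similarity (R : realType) (d : nat) (s : R)
    (f : 'cV[R]_d -> 'cV[R]_d) : Prop :=
  exists U : 'M[R]_d, exists2 c : 'cV[R]_d,
    U^T *m U = 1%:M & forall x, f x = s *: (U *m x) + c.

Lemma similarity_id (R : realType) (d : nat) : similarity 1 (@id 'cV[R]_d).
Proof.
exists 1%:M, 0 => [|x]; first by rewrite trmx1 mulmx1.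
by rewrite mul1mx scale1r addr0.
Qed.

Lemma similarity_comp (R : realType) (d : nat) (s t : R)
    (f g : 'cV[R]_d -> 'cV[R]_d) :
  similarity s f -> similarity t g -> similarity (s * t) (f \o g).
Proof.
move=> [U [c UU fE]] [V [e VV gE]]; exists (U *m V), (s *: (U *m e) + c) => [|x].
  by rewrite trmx_mul mulmxA -(mulmxA V^T) UU mulmx1.
rewrite /= fE gE mulmxDr scalerDr -scalemxAr scalerA addrA -mulmxA.
by [].
Qed.

Lemma similarity_tau (R : realType) (d : nat) (lam : R) (O : 'M[R]_d)
    (b : 'cV[R]_d) : O^T *m O = 1%:M -> similarity lam (tau lam O b).
Proof.
move=> OO; exists O, (lam *: (O *m b)) => // x.
by rewrite /tau mulmxDr scalerDr.
Qed.

Lemma similarity_inv (R : realType) (d : nat) (s : R)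
    (f : 'cV[R]_d -> 'cV[R]_d) : s != 0 -> similarity s f ->
  exists g, [/\ similarity s^-1 g, cancel f g & cancel g f].
Proof.
move=> s0 [U [c UU fE]]; have UU' := mulmx1C UU.
exists (fun y => s^-1 *: (U^T *m (y - c))); split.
- exists U^T, (- (s^-1 *: (U^T *m c))) => [|x]; first by rewrite trmxK.
  by rewrite mulmxBr scalerBr.
- by move=> x; rewrite fE addrK -scalemxAr scalerA mulVf // scale1r mulmxA UU mul1mx.
- move=> x; rewrite fE -scalemxAr scalerA mulfV // scale1r mulmxA UU' mul1mx.
  by rewrite subrK.
Qed.

Lemma similarity_measurable (R : realType) (d : nat) (s : R)
    (f : 'cV[R]_d -> 'cV[R]_d) :
  similarity s f -> measurable_fun setT (f : Rd R d -> Rd R d).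
Proof.
move=> [U [c _ fE]]; rewrite (_ : f = fun x => (s *: U) *m x + c).
  exact: measurable_affine.
by apply/funext => x; rewrite fE scalemxAl.
Qed.

Lemma normsqE (R : realType) (d : nat) (x : 'cV[R]_d) : normsq x = (x^T *m x) 0 0.
Proof. by rewrite mxE; apply: eq_bigr => i _; rewrite mxE expr2. Qed.

Lemma similarity_normsq (R : realType) (d : nat) (s : R)
    (f : 'cV[R]_d -> 'cV[R]_d) (x y : 'cV[R]_d) :
  similarity s f -> normsq (f x - f y) = s ^+ 2 * normsq (x - y).
Proof.
move=> [U [c UU fE]]; rewrite !fE opprD addrACA subrr addr0 -scalerBr -mulmxBr.
rewrite [LHS](_ : _ = s ^+ 2 * normsq (U *m (x - y))); last first.
  by rewrite /normsq mulr_sumr; apply: eq_bigr => i _; rewrite mxE exprMn.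
by rewrite !normsqE trmx_mul -mulmxA (mulmxA U^T) UU mul1mx.
Qed.

Lemma coord_normsq (R : realType) (d : nat) (x : 'cV[R]_d) (i : 'I_d) :
  (x i 0) ^+ 2 <= normsq x.
Proof.
by rewrite /normsq (bigD1 i) //= lerDl sumr_ge0 // => j _; exact: sqr_ge0.
Qed.

(** Passes from the largest entry to the Euclidean norm and back. The sharp loss is the square root
    of [d]; bounding [d] by [d^2] under the square avoids it. *)
Lemma similarity_coord (R : realType) (d : nat) (s r : R)
    (f : 'cV[R]_d -> 'cV[R]_d) (x y : 'cV[R]_d) (i : 'I_d) :
  0 <= s -> similarity s f -> 0 <= r -> (forall j, `|x j 0 - y j 0| <= r) ->
  `|f x i 0 - f y i 0| <= s * (d%:R * r).
Proof.
move=> s0 sf r0 xyr; rewrite -(@ler_pXn2r _ 2) ?nnegrE ?mulr_ge0 ?ler0n //.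
rewrite real_normK ?num_real //.
have -> : f x i 0 - f y i 0 = (f x - f y) i 0 by rewrite !mxE.
apply: (le_trans (coord_normsq _ _)); rewrite (similarity_normsq _ _ sf).
rewrite exprMn ler_wpM2l ?sqr_ge0 //.
apply: (@le_trans _ _ (\sum_(j < d) r ^+ 2)).
  apply: ler_sum => j _; rewrite !mxE -real_normK ?num_real //.
  by rewrite ler_pXn2r ?nnegrE.
rewrite sumr_const card_ord exprMn -[leLHS]mulr_natl ler_wpM2r ?sqr_ge0 //.
by rewrite -natrX ler_nat; case: d {f x y i sf xyr} => // d; rewrite leq_pmulr.
Qed.

Lemma leb_outer_bigsetU (R : realType) (n : nat) (I : Type) (r : seq I)
    (P : pred I) (F : I -> set 'cV[R]_n.+1) :
  (leb_outer (\big[setU/set0]_(i <- r | P i) F i) <=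
   \sum_(i <- r | P i) leb_outer (F i))%E.
Proof.
elim/big_rec2: _ => [|i x A _ h]; first by rewrite [leLHS](outer_measure0 (@leb_outer R n)).
apply: (le_trans (outer_measureU2 (@leb_outer R n) _ _)).
exact: leeD.
Qed.

(* A box is cut into cubes of side at most [e]; the image of such a cube lies
   in a cube of side [2 s d e], whatever the rotation. *)
Lemma leb_outer_similarity_box_eps (R : realType) (n : nat) (s e : R)
    (f : 'cV[R]_n.+1 -> 'cV[R]_n.+1) (a b : 'cV[R]_n.+1) :
  0 < s -> similarity s f -> 0 < e -> (forall i, a i 0 <= b i 0) ->
  (leb_outer (f @` box a b) <=
   ((2 * s * n.+1%:R) ^+ n.+1 * \prod_i (b i 0 - a i 0 + e))%:E)%E.
Proof.
move=> s0 sf e0 ab.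
(* [m i] cells of side [e] cover side [i]. [K] bounds all the [m i], so that cell indices live in a
   single finite function type, restricted by [Q]. *)
pose m (i : 'I_n.+1) := (Num.truncn ((b i 0 - a i 0) / e)).+1.
pose K := (\sum_i m i)%N.
have mK i : (m i <= K)%N by rewrite /K (bigD1 i) //= leq_addr.
pose q (g : {ffun 'I_n.+1 -> 'I_K}) : 'cV[R]_n.+1 := \col_i (a i 0 + e * (g i)%:R).
pose r := s * (n.+1%:R * e).
have r0 : 0 <= r by rewrite !mulr_ge0 ?(ltW s0) ?(ltW e0).
pose B g := box (f (q g) - const_mx r) (f (q g) + const_mx r).
pose Q (i : 'I_n.+1) := [pred j : 'I_K | (j < m i)%N].
have sub : f @` box a b `<=` \big[setU/set0]_(g in family Q) B g.
  move=> _ [x xab <-].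
  have x0 i : 0 <= (x i 0 - a i 0) / e.
    by rewrite divr_ge0 ?(ltW e0) // subr_ge0; have /andP[] := xab i.
  have xm i : (Num.truncn ((x i 0 - a i 0) / e)%R < m i)%N.
    rewrite ltnS le_truncn // ler_pM2r ?invr_gt0 // lerD2r.
    by have /andP[] := xab i.
  pose g := [ffun i => Ordinal (leq_trans (xm i) (mK i))].
  have gQ : g \in family Q by apply/familyP => i; rewrite ffunE inE /=.
  rewrite (bigD1 g) //=; left => i; rewrite !mxE -ler_distl.
  apply: similarity_coord (ltW s0) sf (ltW e0) _ => j.
  have /andP[h1 h2] := truncn_itv (x0 j).
  rewrite mxE ffunE /= opprD addrA ger0_norm.
    rewrite lerBlDr -[X in _ <= X + _]mulr1 -mulrDr -ler_pdivrMl // mulrC.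
    by rewrite (le_trans (ltW h2)) // -natr1 addrC.
  by rewrite subr_ge0 -ler_pdivlMl // [leRHS]mulrC.
apply: (le_trans (le_outer_measure (@leb_outer R n) _ _ sub)).
apply: (le_trans (leb_outer_bigsetU _ _ _)).
apply: (@le_trans _ _ (\sum_(g in family Q) ((2 * s * n.+1%:R) ^+ n.+1 *
    \prod_(i < n.+1) e)%:E)%E).
  apply: lee_sum => g _; apply: le_trans (leb_outer_box _) _.
    by move=> i; rewrite !mxE lerD2l (le_trans _ r0) // oppr_le0.
  rewrite lee_fin /box_vol !prodr_const card_ord -exprMn.
  rewrite (eq_bigr (fun=> 2 * s * n.+1%:R * e)) ?prodr_const ?card_ord //.
  by move=> i _; rewrite !mxE /r; ring.
rewrite sumEFin lee_fin -mulr_sumr ler_wpM2l ?exprn_ge0 ?mulr_ge0 ?(ltW s0) //.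
(* The number of cells times [e^d] factors over the axes, and [m i * e <= b_i - a_i + e]. *)
rewrite -(bigA_distr_big_dep _ (fun _ _ => e)) /=.
apply: ler_prod => i _; rewrite sumr_ge0 => [/=|j _]; last exact: ltW.
rewrite sumr_const (_ : #|_| = m i).
  rewrite -mulr_natr mulrC -ler_pdivlMr // mulrDl divff ?gt_eqF //.
  by rewrite -natr1 lerD2r truncn_le divr_ge0 ?(ltW e0) // subr_ge0.
rewrite -sum1_card -(big_mkord (fun j => j < m i)%N (fun=> 1%N)).
by rewrite -(big_nat_widen 0 (m i) K xpredT) // sum_nat_const_nat subn0 muln1.
Qed.

(** The mesh [e] is free and the bound is a polynomial in [e], so a strict failure at [e = 0] would
    persist for small positive [e]. *)
Lemma leb_outer_similarity_box (R : realType) (n : nat) (s : R)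
    (f : 'cV[R]_n.+1 -> 'cV[R]_n.+1) (a b : 'cV[R]_n.+1) :
  0 < s -> similarity s f -> (forall i, a i 0 <= b i 0) ->
  (leb_outer (f @` box a b) <=
   ((2 * s * n.+1%:R) ^+ n.+1 * box_vol a b)%:E)%E.
Proof.
move=> s0 sf ab; rewrite leNgt; apply/negP.
set C := _ ^+ _; set L := leb_outer _ => CL.
have Lub e : 0 < e -> (L <= (C * \prod_i (b i 0 - a i 0 + e))%:E)%E.
  by move=> e0; exact: leb_outer_similarity_box_eps.
pose P : {poly R} := C%:P * \prod_i ((b i 0 - a i 0)%:P + 'X).
have PE e : P.[e] = C * \prod_i (b i 0 - a i 0 + e).
  rewrite hornerM hornerC horner_prod; congr (_ * _).
  by apply: eq_bigr => i _; rewrite !hornerE.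
have Lfin : L \is a fin_num.
  rewrite ge0_fin_numE; last exact: (outer_measure_ge0 (@leb_outer R n)).
  exact: le_lt_trans (Lub 1 ltr01) (ltry _).
have P0L : P.[0] < fine L.
  rewrite -lte_fin (fineK Lfin) PE; apply: le_lt_trans CL.
  by rewrite lee_fin /box_vol; under eq_bigr do rewrite addr0.
have /nbhs_ballP[e /= e0 eL] : \forall x \near 0, P.[x] < fine L.
  exact: cvgr_lt (@continuous_horner _ P 0) _ P0L.
have e20 : 0 < e / 2 by rewrite divr_gt0.
have : P.[e / 2] < fine L.
  apply: eL; rewrite /ball /= sub0r normrN gtr0_norm //.
  by rewrite ltr_pdivrMr // mulr_natr mulr2n ltrDl.
by rewrite -lte_fin (fineK Lfin) PE ltNge Lub.
Qed.

Lemma leb_similarity (R : realType) (n : nat) (s : R)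
    (f : 'cV[R]_n.+1 -> 'cV[R]_n.+1) (A : set 'cV[R]_n.+1) :
  0 < s -> similarity s f ->
  (leb (f @` A) <= ((2 * s * n.+1%:R) ^+ n.+1)%:E * leb A)%E.
Proof.
move=> s0 sf; rewrite /leb; set C := _ ^+ _.
have C0 : 0 < C by rewrite exprn_gt0 // !mulr_gt0.
have [->|] := eqVneq (leb_outer A) +oo%E; first by rewrite gt0_muley ?lte_fin // leey.
rewrite -ltey => Aoo.
have Afin : leb_outer A \is a fin_num.
  rewrite ge0_fin_numE //; exact: (outer_measure_ge0 (@leb_outer R n)).
rewrite -(fineK Afin) -lee_pdivrMl //.
apply/lee_addgt0Pr => e e0.
have [|a [b [ab Aab sab]]] := @leb_outer_cover R n A (fine (leb_outer A) + e).
  by rewrite EFinD fineK // lteDl // lte_fin.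
rewrite lee_pdivrMl // -EFinD.
apply: (@le_trans _ _ (\sum_(k <oo) leb_outer (f @` box (a k) (b k)))%E).
  apply: le_trans (outer_measure_sigma_subadditive (@leb_outer R n) _).
  apply: (le_outer_measure (@leb_outer R n)) => _ [x /Aab[k _ xk] <-].
  by exists k => //; exists x.
apply: (@le_trans _ _ (\sum_(k <oo) (C%:E * (box_vol (a k) (b k))%:E))%E).
  apply: lee_nneseries => [k _ _|k _].
    exact: (outer_measure_ge0 (@leb_outer R n)).
  by rewrite -EFinM; exact: leb_outer_similarity_box.
rewrite nneseriesZl; last by move=> k _; rewrite lee_fin box_vol_ge0.
by rewrite lee_pmul2l // lte_fin.
Qed.

(** * Density of an absolutely continuous probability measure *)

Definition vshift (R : realType) (d : nat) (t x : 'cV[R]_d) : 'cV[R]_d := x + t.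

Lemma leb_translate_le (R : realType) (n : nat) (t : 'cV[R]_n.+1)
    (A : set 'cV[R]_n.+1) :
  (leb_outer (vshift t @^-1` A) <= leb_outer A)%E.
Proof.
have [->|] := eqVneq (leb_outer A) +oo%E; first exact: leey.
rewrite -ltey => Aoo.
have Afin : leb_outer A \is a fin_num.
  rewrite ge0_fin_numE //; exact: (outer_measure_ge0 (@leb_outer R n)).
apply/lee_addgt0Pr => e e0.
have [|a [b [ab Aab sab]]] := @leb_outer_cover R n A (fine (leb_outer A) + e).
  by rewrite EFinD fineK // lteDl // lte_fin.
rewrite -(fineK Afin) -EFinD; apply: le_trans sab.
apply: (le_trans (@leb_outer_le_cover R n _ (fun k => a k - t) (fun k => b k - t) _ _)).
- by move=> k i; rewrite !mxE lerD2r.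
- move=> x /Aab[k _ xk]; exists k => // i; have := xk i.
  by rewrite !mxE lerBlDr lerBrDr.
- apply: lee_nneseries => [k _ _|k _].
    by rewrite lee_fin box_vol_ge0 // => i; rewrite !mxE lerD2r.
  rewrite lee_fin /box_vol le_eqVlt; apply/orP; left; apply/eqP.
  by apply: eq_bigr => i _; rewrite !mxE; ring.
Qed.

Lemma leb_translate (R : realType) (n : nat) (t : 'cV[R]_n.+1)
    (A : set 'cV[R]_n.+1) :
  leb (vshift t @^-1` A) = leb A.
Proof.
apply/eqP; rewrite eq_le; apply/andP; split; first exact: leb_translate_le.
have := leb_translate_le (- t) (vshift t @^-1` A).
by rewrite -comp_preimage (_ : _ \o _ = id) //; apply/funext => x /=; rewrite /vshift subrK.
Qed.

Lemma translate_measurable (R : realType) (d : nat) (t : 'cV[R]_d) :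
  measurable_fun setT (vshift t : Rd R d -> Rd R d).
Proof.
rewrite (_ : vshift t = fun x : 'cV[R]_d => 1%:M *m x + t).
  exact: measurable_affine.
by apply/funext => x; rewrite mul1mx.
Qed.

Lemma translate_preimage_measurable (R : realType) (d : nat) (t : 'cV[R]_d)
    (A : set (Rd R d)) :
  measurable A -> measurable (vshift t @^-1` A : set (Rd R d)).
Proof.
by move=> mA; rewrite -[X in measurable X]setTI; exact: translate_measurable.
Qed.

(* Tonelli: the integral over [t] of leb (F `&` (E - t)) is leb F * leb E. *)
Lemma leb_translate_meet (R : realType) (n : nat) (E F : set (Rd R n.+1)) :
  measurable E -> measurable F -> (0 < leb E)%E -> (0 < leb F)%E ->
  exists t : 'cV[R]_n.+1, (0 < leb (F `&` vshift t @^-1` E))%E.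
Proof.
move=> mE mF E0 F0; apply: contrapT => /forallNP h.
have {}h (t : 'cV[R]_n.+1) : leb (F `&` vshift t @^-1` E) = 0.
  by apply/eqP; rewrite eq_le measure_ge0 andbT leNgt; apply/negP/h.
pose T := Rd R n.+1.
pose add (z : T * T) : T := (z.1 : 'cV[R]_n.+1) + (z.2 : 'cV[R]_n.+1).
have madd : measurable_fun setT add.
  apply: measurable_fun_Rd => i.
  rewrite (_ : (fun _ => _) = (fun z : T * T => (z.1 : 'cV[R]_n.+1) i 0 +
     (z.2 : 'cV[R]_n.+1) i 0)); last by apply/funext => z; rewrite mxE.
  apply: measurable_funD.
    exact: (measurableT_comp (measurable_coord i) measurable_fst).
  exact: (measurableT_comp (measurable_coord i) measurable_snd).
(* The pairs [(x, t)] with [x] in [F] and [x + t] in [E]. Slices at fixed [t] are null by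
   assumption; slices at fixed [x] in [F] are translates of [E]. *)
pose A : set (T * T) := (fst @^-1` F) `&` (add @^-1` E).
have mA : measurable A.
  apply: measurableI; rewrite -[X in measurable X]setTI.
    exact: measurable_fst.
  exact: madd.
have := @indic_fubini_tonelli _ _ T T R (@leb R n) (@leb R n) A mA.
rewrite indic_fubini_tonelli_FE // indic_fubini_tonelli_GE //.
rewrite [X in _ = X -> _](_ : _ = 0); last first.
  apply: integral0_eq => t _ /=; rewrite (_ : ysection _ _ = F `&` vshift t @^-1` E) //.
  by apply/seteqP; split=> x; rewrite /ysection /= inE.
rewrite (_ : _ \o _ = fun x => (leb E * (\1_F x)%:E)%E); last first.
  apply/funext => x /=; rewrite indicE; have [xF|xF] := boolP (x \in F).
    rewrite mule1 -(leb_translate x E); congr (leb _).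
    apply/seteqP; split=> y; rewrite /xsection /= inE /A /add /=.
      by move=> [_]; rewrite addrC.
    by move=> h'; split; [exact: set_mem|rewrite addrC].
  rewrite mule0 (_ : xsection _ _ = set0) ?measure0 // -subset0 => y.
  by rewrite /xsection /= inE => -[Fx _]; move: xF; rewrite (mem_set (Fx : F x)).
rewrite ge0_integralZl //; last first.
  exact/measurable_EFinP/measurable_indic.
rewrite integral_indic // setIT => /eqP.
by rewrite mule_eq0 !gt_eqF.
Qed.

(** * The Radon-Nikodym density and its reciprocal *)

Definition density (R : realType) (n : nat) (mu : probability (Rd R n.+1) R)
    (x : Rd R n.+1) : R :=
  fine (Radon_Nikodym (charge_of_finite_measure mu) (@leb R n) x).

Lemma density_EFin (R : realType) (n : nat) (mu : probability (Rd R n.+1) R)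
    (x : Rd R n.+1) : mu `<< @leb R n ->
  (density mu x)%:E = Radon_Nikodym (charge_of_finite_measure mu) (@leb R n) x.
Proof.
move=> ac; rewrite fineK //; apply: Radon_Nikodym_fin_num.
exact: ac.
Qed.

Lemma density_measurable (R : realType) (n : nat)
    (mu : probability (Rd R n.+1) R) : mu `<< @leb R n ->
  measurable_fun setT (density mu).
Proof.
move=> ac; apply/measurable_EFinP.
rewrite (_ : _ \o _ = Radon_Nikodym (charge_of_finite_measure mu) (@leb R n)).
  by apply: (measurable_int (@leb R n)); exact: Radon_Nikodym_integrable.
by apply/funext => x /=; rewrite density_EFin.
Qed.

Lemma density_integral (R : realType) (n : nat) (mu : probability (Rd R n.+1) R)
    (A : set (Rd R n.+1)) : mu `<< @leb R n -> measurable A ->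
  mu A = (\int[@leb R n]_(x in A) (density mu x)%:E)%E.
Proof.
move=> ac mA; transitivity (charge_of_finite_measure mu A) => //.
rewrite (@Radon_Nikodym_integral _ _ _ (charge_of_finite_measure mu) (@leb R n)) //.
by apply: eq_integral => x _; rewrite density_EFin.
Qed.

(* On [G], [expR (- ln (density x))] is [1 / density x] wherever the density is
   positive; [expR] and [ln] are known to be measurable, unlike inversion. *)
Definition recip_density (R : realType) (n : nat)
    (mu : probability (Rd R n.+1) R) (G : set 'cV[R]_n.+1) (x : 'cV[R]_n.+1) : R :=
  \1_G x * expR (- ln (density mu x)).

Lemma recip_density_measurable (R : realType) (n : nat)
    (mu : probability (Rd R n.+1) R) (G : set (Rd R n.+1)) :
  mu `<< @leb R n -> measurable G ->
  measurable_fun setT (recip_density mu G : Rd R n.+1 -> R).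
Proof.
move=> ac mG; apply: measurable_funM; first exact: measurable_indic.
apply: measurableT_comp => //; apply: measurableT_comp => //.
by apply: measurableT_comp (density_measurable ac); exact: measurable_ln.
Qed.

Lemma recip_densityE (R : realType) (n : nat) (mu : probability (Rd R n.+1) R)
    (G : set 'cV[R]_n.+1) (x : 'cV[R]_n.+1) :
  G x -> 0 < density mu x -> recip_density mu G x = (density mu x)^-1.
Proof.
by move=> Gx px; rewrite /recip_density indicE mem_set // mul1r expRN lnK.
Qed.

Lemma recip_density_ge0 (R : realType) (n : nat) (mu : probability (Rd R n.+1) R)
    (G : set 'cV[R]_n.+1) (x : 'cV[R]_n.+1) : 0 <= recip_density mu G x.
Proof. by rewrite mulr_ge0 ?expR_ge0 // indicE. Qed.

Lemma recip_density_le (R : realType) (n : nat) (mu : probability (Rd R n.+1) R)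
    (G : set 'cV[R]_n.+1) (a : R) (x : 'cV[R]_n.+1) : 0 < a ->
  (forall y, G y -> a <= density mu y) -> recip_density mu G x <= a^-1.
Proof.
move=> a0 Ga; have [Gx|Gx] := pselect (G x).
  have px := lt_le_trans a0 (Ga _ Gx).
  by rewrite recip_densityE // lef_pV2 ?posrE // Ga.
by rewrite /recip_density indicE memNset // mul0r invr_ge0 ltW.
Qed.

(** The weight cancels the density on [G], so a [mu]-integral becomes a Lebesgue integral. The lower
    bound [a] keeps the integrand bounded, hence integrable, as the change of variables demands. *)
Lemma recip_density_integral (R : realType) (n : nat)
    (mu : probability (Rd R n.+1) R) (G : set (Rd R n.+1)) (a C : R)
    (h : Rd R n.+1 -> R) :
  mu `<< @leb R n -> measurable G -> 0 < a ->
  (forall x, G x -> a <= density mu x) ->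
  measurable_fun setT h -> (forall x, G x -> `|h x| <= C) ->
  (\int[mu]_x (recip_density mu G x * h x)%:E =
   \int[@leb R n]_(x in G) (h x)%:E)%E.
Proof.
move=> ac mG a0 Ga mh hC.
have int : mu.-integrable setT (EFin \o (fun x => recip_density mu G x * h x)).
  apply: measurable_bounded_integrable => //.
  - by rewrite (le_lt_trans (probability_le1 mu _)) // ltry.
  - by apply: measurable_funM => //; exact: recip_density_measurable.
  (* [C] may be negative when [G] is empty, hence the absolute value. *)
  exists (a^-1 * `|C|); split; first exact: num_real.
  move=> M /ltW CM x _ /=; apply: le_trans CM; rewrite normrM.
  have [Gx|Gx] := pselect (G x); last first.
    by rewrite /recip_density indicE memNset // !mul0r normr0 mul0r mulr_ge0 // invr_ge0 ltW.
  apply: ler_pM => //; last exact: le_trans (hC _ Gx) (ler_norm _).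
  by rewrite ger0_norm ?recip_density_ge0 // recip_density_le.
rewrite -[LHS](@Radon_Nikodym_change_of_variables _ _ _ mu (@leb R n) ac) //.
rewrite [RHS]integral_mkcond; apply: eq_integral => x _.
rewrite -density_EFin // -EFinM patchE; have [/set_mem Gx|/negP xG] := boolP (x \in G).
  have px := lt_le_trans a0 (Ga _ Gx).
  by rewrite recip_densityE // mulrAC mulVf ?mul1r // gt_eqF.
by rewrite /recip_density indicE (negbTE (introN idP xG)) !mul0r.
Qed.

(** * Frame measures *)

Lemma dotv_measurable (R : realType) (d : nat) (t : 'cV[R]_d) :
  measurable_fun setT (dotv t : Rd R d -> R).
Proof.
apply: measurable_sum => i; apply: measurable_funM => //; exact: measurable_coord.
Qed.

Lemma cos_dotv_measurable (R : realType) (d : nat) (t : 'cV[R]_d) :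
  measurable_fun setT (fun x : Rd R d => cos (2 * pi * dotv t x)).
Proof.
apply: measurableT_comp; last by apply: measurable_funM => //; exact: dotv_measurable.
by apply: continuous_measurable_fun; exact: continuous_cos.
Qed.

Lemma sin_dotv_measurable (R : realType) (d : nat) (t : 'cV[R]_d) :
  measurable_fun setT (fun x : Rd R d => sin (2 * pi * dotv t x)).
Proof.
apply: measurableT_comp; last by apply: measurable_funM => //; exact: dotv_measurable.
by apply: continuous_measurable_fun; exact: continuous_sin.
Qed.

Lemma bounded_integrable_leb (R : realType) (n : nat) (G : set (Rd R n.+1))
    (h : Rd R n.+1 -> R) :
  measurable G -> (leb G < +oo)%E -> measurable_fun setT h ->
  (forall x, `|h x| <= 1) -> (@leb R n).-integrable G (EFin \o h).
Proof.
move=> mG Goo mh h1; apply: measurable_bounded_integrable => //.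
  exact: measurable_funTS.
exists 1; split; first exact: num_real.
by move=> M /ltW M1 x _ /=; exact: le_trans (h1 x) M1.
Qed.

Lemma cos_abs_le1 (R : realType) (x : R) : `|cos x| <= 1.
Proof. by rewrite ler_norml cos_geN1 cos_le1. Qed.

Lemma sin_abs_le1 (R : realType) (x : R) : `|sin x| <= 1.
Proof. by rewrite ler_norml sin_geN1 sin_le1. Qed.

Lemma ft_re_recip_density (R : realType) (n : nat)
    (mu : probability (Rd R n.+1) R) (G : set (Rd R n.+1)) (a : R)
    (t : 'cV[R]_n.+1) :
  mu `<< @leb R n -> measurable G -> 0 < a ->
  (forall x, G x -> a <= density mu x) ->
  ft_re mu (recip_density mu G) (fun=> 0) t =
  Rintegral (@leb R n) G (fun x => cos (2 * pi * dotv t x)).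
Proof.
move=> ac mG a0 Ga; rewrite /ft_re /Rintegral; congr fine.
rewrite -(recip_density_integral ac mG a0 Ga (cos_dotv_measurable t)
  (fun x _ => cos_abs_le1 _)).
by apply: eq_integral => x _; rewrite mul0r addr0.
Qed.

Lemma ft_im_recip_density (R : realType) (n : nat)
    (mu : probability (Rd R n.+1) R) (G : set (Rd R n.+1)) (a : R)
    (t : 'cV[R]_n.+1) :
  mu `<< @leb R n -> measurable G -> (leb G < +oo)%E -> 0 < a ->
  (forall x, G x -> a <= density mu x) ->
  ft_im mu (recip_density mu G) (fun=> 0) t =
  - Rintegral (@leb R n) G (fun x => sin (2 * pi * dotv t x)).
Proof.
move=> ac mG Goo a0 Ga; rewrite -mulN1r -RintegralZl //; last first.
  by apply: bounded_integrable_leb => // [|x]; [exact: sin_dotv_measurable|exact: sin_abs_le1].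
rewrite /ft_im /Rintegral; congr fine.
have mh : measurable_fun setT (fun x : Rd R n.+1 => -1 * sin (2 * pi * dotv t x)).
  by apply: measurable_funM => //; exact: sin_dotv_measurable.
rewrite -(recip_density_integral (C := 1) ac mG a0 Ga mh); last first.
  by move=> x _; rewrite mulN1r normrN sin_abs_le1.
by apply: eq_integral => x _; rewrite mul0r sub0r mulN1r mulrN.
Qed.

Lemma Rintegral_vshift (R : realType) (n : nat) (t : 'cV[R]_n.+1)
    (H : set (Rd R n.+1)) (h : Rd R n.+1 -> R) :
  measurable H -> (leb H < +oo)%E -> measurable_fun setT h ->
  (forall x, `|h x| <= 1) ->
  Rintegral (@leb R n) H h = Rintegral (@leb R n) (vshift t @^-1` H) (h \o vshift t).
Proof.
move=> mH Hoo mh h1; rewrite /Rintegral; congr fine.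
pose sh : Rd R n.+1 -> Rd R n.+1 := vshift t.
have mt : measurable_fun setT sh by exact: translate_measurable.
rewrite (@eq_measure_integral _ _ _ _ (pushforward (@leb R n) sh)); last first.
  by move=> A _ _; exact: (esym (leb_translate t A)).
rewrite integral_pushforward //; first exact/measurable_EFinP.
apply: bounded_integrable_leb => //.
- exact: translate_preimage_measurable.
- by rewrite leb_translate.
- exact: measurableT_comp.
Qed.

(* A translation multiplies the Fourier transform by a phase. *)
Lemma leb_ft_vshift (R : realType) (n : nat) (t s : 'cV[R]_n.+1)
    (H : set (Rd R n.+1)) :
  measurable H -> (leb H < +oo)%E ->
  let C G := Rintegral (@leb R n) G (fun x => cos (2 * pi * dotv s x)) in
  let S G := Rintegral (@leb R n) G (fun x => sin (2 * pi * dotv s x)) in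
  (C H) ^+ 2 + (S H) ^+ 2 = (C (vshift t @^-1` H)) ^+ 2 + (S (vshift t @^-1` H)) ^+ 2.
Proof.
move=> mH Hoo C S; set G : set (Rd R n.+1) := vshift t @^-1` H.
have mG : measurable G by exact: translate_preimage_measurable.
have Goo : (leb G < +oo)%E by rewrite leb_translate.
pose w := 2 * pi * dotv s t.
have dotD x : 2 * pi * dotv s (vshift t x) = 2 * pi * dotv s x + w.
  rewrite /w -mulrDr -big_split /=; congr (_ * _).
  by apply: eq_bigr => i _; rewrite mxE mulrDr.
have ic : (@leb R n).-integrable G (EFin \o (fun x => cos (2 * pi * dotv s x))).
  by apply: bounded_integrable_leb => // [|x]; [exact: cos_dotv_measurable|exact: cos_abs_le1].
have is_ : (@leb R n).-integrable G (EFin \o (fun x => sin (2 * pi * dotv s x))).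
  by apply: bounded_integrable_leb => // [|x]; [exact: sin_dotv_measurable|exact: sin_abs_le1].
have zint (r : R) (h : Rd R n.+1 -> R) : (@leb R n).-integrable G (EFin \o h) ->
    (@leb R n).-integrable G (EFin \o (fun x => r * h x)).
  by move=> ih; exact: (integrableZl mG r ih).
(* The pair of integrals over [H] is the pair over [G] rotated by the angle [w]. *)
have CH : C H = cos w * C G - sin w * S G.
  rewrite /C (Rintegral_vshift t) //; [|exact: cos_dotv_measurable|by move=> x; exact: cos_abs_le1].
  rewrite -!RintegralZl // -RintegralB //; [|exact: zint..].
  by apply: eq_Rintegral => x _; rewrite /= dotD cosD; ring.
have SH : S H = cos w * S G + sin w * C G.
  rewrite /S (Rintegral_vshift t) //; [|exact: sin_dotv_measurable|by move=> x; exact: sin_abs_le1].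
  rewrite -!RintegralZl // -RintegralD //; [|exact: zint..].
  by apply: eq_Rintegral => x _; rewrite /= dotD sinD; ring.
have := cos2Dsin2 w; rewrite CH SH => cs.
by rewrite -[RHS]mul1r -cs; ring.
Qed.

Lemma density_ge (R : realType) (n : nat) (mu : probability (Rd R n.+1) R)
    (G : set (Rd R n.+1)) (a : R) :
  mu `<< @leb R n -> measurable G -> 0 <= a ->
  (forall x, G x -> a <= density mu x) -> (a%:E * leb G <= mu G)%E.
Proof.
move=> ac mG a0 Ga; rewrite (density_integral ac mG) -integral_cst //.
apply: ge0_le_integral => //.
by apply/measurable_EFinP; apply: measurable_funTS; exact: density_measurable.
Qed.

(** One of the two factors [1 / phi] cancels against the density. *)
Lemma recip_density_L2 (R : realType) (n : nat) (mu : probability (Rd R n.+1) R)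
    (G : set (Rd R n.+1)) (a : R) :
  mu `<< @leb R n -> measurable G -> 0 < a ->
  (forall x, G x -> a <= density mu x) ->
  L2norm2 mu (recip_density mu G) (fun=> 0) =
  (\int[@leb R n]_(x in G) (recip_density mu G x)%:E)%E.
Proof.
move=> ac mG a0 Ga; rewrite -(@recip_density_integral _ _ mu _ a (a^-1)) //.
- by apply: eq_integral => x _; rewrite expr0n /= addr0 expr2.
- exact: recip_density_measurable.
- by move=> x _; rewrite ger0_norm ?recip_density_ge0 // recip_density_le.
Qed.

Lemma recip_density_L2_le (R : realType) (n : nat) (mu : probability (Rd R n.+1) R)
    (G : set (Rd R n.+1)) (a : R) :
  mu `<< @leb R n -> measurable G -> 0 < a ->
  (forall x, G x -> a <= density mu x) ->
  (L2norm2 mu (recip_density mu G) (fun=> 0%R) <= (a^-1)%:E * leb G)%E.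
Proof.
move=> ac mG a0 Ga; rewrite (recip_density_L2 ac mG a0 Ga) -integral_cst //.
apply: ge0_le_integral => //.
- by move=> x _; rewrite lee_fin recip_density_ge0.
- by apply/measurable_EFinP; apply: measurable_funTS; exact: recip_density_measurable.
- by move=> x Gx; rewrite lee_fin recip_density_le.
Qed.

Lemma recip_density_L2_ge (R : realType) (n : nat) (mu : probability (Rd R n.+1) R)
    (G : set (Rd R n.+1)) (a b : R) :
  mu `<< @leb R n -> measurable G -> 0 < a -> 0 < b ->
  (forall x, G x -> a <= density mu x <= b) ->
  ((b^-1)%:E * leb G <= L2norm2 mu (recip_density mu G) (fun=> 0%R))%E.
Proof.
move=> ac mG a0 b0 Gab.
have Ga x : G x -> a <= density mu x by move=> /Gab/andP[].
rewrite (recip_density_L2 ac mG a0 Ga) -integral_cst //.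
apply: ge0_le_integral => //.
- by move=> x _; rewrite lee_fin invr_ge0 ltW.
- by apply/measurable_EFinP; apply: measurable_funTS; exact: recip_density_measurable.
- move=> x Gx; have px := lt_le_trans a0 (Ga _ Gx).
  by rewrite lee_fin recip_densityE // lef_pV2 ?posrE //; have /andP[] := Gab _ Gx.
Qed.

(* If H = G + t then 1_G / density and 1_H / density have, with respect to mu,
   Fourier transforms of the same modulus, so the frame bounds compare their
   L2 norms. *)
Lemma frame_density_ratio (R : realType) (n : nat) (mu : probability (Rd R n.+1) R)
    (nu : {measure set Rd R n.+1 -> \bar R}) (A B : R) (E F : set (Rd R n.+1))
    (a b c : R) :
  0 < A -> 0 < B ->
  (forall u v : 'cV[R]_n.+1 -> R, inL2 mu u v ->
    let I := (\int[nu]_(t in [set: Rd R n.+1])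
                ((ft_re mu u v t) ^+ 2 + (ft_im mu u v t) ^+ 2)%:E)%E in
    (A%:E * L2norm2 mu u v <= I)%E /\ (I <= B%:E * L2norm2 mu u v)%E) ->
  mu `<< @leb R n -> measurable E -> measurable F -> 0 < a -> 0 < c ->
  (forall x, E x -> a <= density mu x) ->
  (forall x, F x -> c <= density mu x <= b) ->
  (0 < leb E)%E -> (0 < leb F)%E -> A * a <= B * b.
Proof.
move=> A0 B0 frame ac mE mF a0 c0 Ea Fb E0 F0.
have [t t0] := leb_translate_meet mE mF E0 F0.
(* Translates on which the frame is tested: [G] inside [F], and [H = G + t] inside [E]. *)
set G : set (Rd R n.+1) := F `&` _ in t0; pose H : set (Rd R n.+1) := vshift (- t) @^-1` G.
have mG : measurable G by apply: measurableI => //; exact: translate_preimage_measurable.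
have mH : measurable H by exact: translate_preimage_measurable.
have HG : vshift t @^-1` H = G.
  by apply/seteqP; split=> x; rewrite /H /= /vshift addrK.
have Ha x : H x -> a <= density mu x.
  by move=> [_]; rewrite /= /vshift subrK; exact: Ea.
have Gb x : G x -> c <= density mu x <= b by move=> [/Fb].
have Gc x : G x -> c <= density mu x by move=> /Gb/andP[].
have b0 : 0 < b.
  have [x Gx] : G !=set0.
    by apply/set0P/eqP => G0; move: t0; rewrite G0 measure0 ltxx.
  by apply: lt_le_trans c0 _; have /andP[] := Gb _ Gx; exact: le_trans.
(* Mass at most 1 and density at least [c] force finite volume. [c] serves only for positivity and
   finiteness and does not enter the conclusion. *)
have Goo : (leb G < +oo)%E.
  rewrite -(@lte_pmul2l _ c%:E) // ?lte_fin // gt0_muley ?lte_fin //.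
  apply: le_lt_trans (density_ge ac mG (ltW c0) Gc) _.
  by rewrite (le_lt_trans (probability_le1 mu _)) // ltry.
have lebHG : leb H = leb G by rewrite /H leb_translate.
have Hoo : (leb H < +oo)%E by rewrite lebHG.
have inH : inL2 mu (recip_density mu H) (fun=> 0).
  split; first exact: recip_density_measurable.
  split; first exact: measurable_cst.
  apply: le_lt_trans (recip_density_L2_le ac mH a0 Ha) _.
  by rewrite lte_mul_pinfty // lee_fin invr_ge0 ltW.
have inG : inL2 mu (recip_density mu G) (fun=> 0).
  split; first exact: recip_density_measurable.
  split; first exact: measurable_cst.
  apply: le_lt_trans (recip_density_L2_le ac mG c0 Gc) _.
  by rewrite lte_mul_pinfty // lee_fin invr_ge0 ltW.
have [lo _] := frame _ _ inG; have [_ hi] := frame _ _ inH.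
(* Both sides are multiples of [leb G], which is positive and finite and cancels. *)
have : (A%:E * ((b^-1)%:E * leb G) <= B%:E * ((a^-1)%:E * leb G))%E.
  apply: (@le_trans _ _ (A%:E * L2norm2 mu (recip_density mu G) (fun=> 0%R))%E).
    by rewrite lee_pmul2l ?lte_fin //; exact: recip_density_L2_ge c0 b0 Gb.
  apply: (le_trans lo); rewrite -lebHG.
  apply: (@le_trans _ _ (B%:E * L2norm2 mu (recip_density mu H) (fun=> 0%R))%E).
    apply: le_trans hi; rewrite le_eqVlt; apply/orP; left; apply/eqP.
    apply: eq_integral => s _; congr EFin.
    rewrite (ft_re_recip_density s ac mG c0 Gc) (ft_im_recip_density s ac mG Goo c0 Gc).
    rewrite (ft_re_recip_density s ac mH a0 Ha) (ft_im_recip_density s ac mH Hoo a0 Ha).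
    by rewrite !sqrrN; have /= -> := leb_ft_vshift t s mH Hoo; rewrite HG.
  by rewrite lee_pmul2l ?lte_fin //; exact: recip_density_L2_le.
have Gfin : leb G \is a fin_num by rewrite ge0_fin_numE // measure_ge0.
rewrite !muleA -!EFinM lee_pmul2r // lee_fin.
by rewrite ler_pdivrMr // mulrAC ler_pdivlMr.
Qed.

(** * Two-sided bounds on the density *)

Lemma density_itv_measurable (R : realType) (n : nat)
    (mu : probability (Rd R n.+1) R) (i : interval R) : mu `<< @leb R n ->
  measurable (density mu @^-1` [set` i] : set (Rd R n.+1)).
Proof.
move=> ac; rewrite -[X in measurable X]setTI.
by apply: (density_measurable ac) => //; exact: measurable_itv.
Qed.

(** The Radon-Nikodym derivative comes without a pointwise sign; on this set the nonnegative [mu] is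
    the integral of a nonpositive function. *)
Lemma density_nonpos_null (R : realType) (n : nat)
    (mu : probability (Rd R n.+1) R) : mu `<< @leb R n ->
  mu (density mu @^-1` `]-oo, 0]) = 0.
Proof.
move=> ac; have mN := density_itv_measurable `]-oo, 0] ac.
apply/eqP; rewrite eq_le measure_ge0 andbT (density_integral ac mN).
have nonpos x : (density mu @^-1` `]-oo, 0]) x -> (0 <= (- density mu x)%:E)%E.
  by rewrite /= in_itv /= lee_fin oppr_ge0.
under eq_integral do rewrite -[density mu _]opprK EFinN.
by rewrite integral_ge0N // oppe_le0 integral_ge0.
Qed.

(** Integrals are compared for nonnegative integrands, so the part where the density is not positive
    is first removed as [mu]-null. *)
Lemma density_le (R : realType) (n : nat) (mu : probability (Rd R n.+1) R)
    (G : set (Rd R n.+1)) (M : R) :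
  mu `<< @leb R n -> measurable G -> 0 < M ->
  (forall x, G x -> density mu x <= M) -> (mu G <= M%:E * leb G)%E.
Proof.
move=> ac mG M0 GM; pose P : set (Rd R n.+1) := density mu @^-1` `]0, +oo[.
have mP : measurable P by exact: density_itv_measurable.
have mGP : measurable (G `&` P) by exact: measurableI.
apply: (@le_trans _ _ (mu (G `&` P))).
  rewrite (measureDI mu mG mP) -[leRHS]add0e leeD2r //.
  rewrite -(density_nonpos_null ac) le_measure ?inE //.
  - exact: measurableD.
  - exact: density_itv_measurable.
  - by move=> x [_]; rewrite /P /= !in_itv /= andbT => /negP; rewrite -leNgt.
apply: (@le_trans _ _ (M%:E * leb (G `&` P))%E).
  rewrite (density_integral ac mGP) -integral_cst //.
  apply: ge0_le_integral => //.
  - by move=> x [_]; rewrite /P /= in_itv /= andbT lee_fin => /ltW.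
  - by apply/measurable_EFinP; apply: measurable_funTS; exact: density_measurable.
  - by move=> x [Gx _]; rewrite lee_fin GM.
by rewrite lee_pmul2l ?lte_fin // le_measure ?inE.
Qed.

Lemma null_dominates_eq0 (R : realType) (n : nat)
    (mu : probability (Rd R n.+1) R) (A : set (Rd R n.+1)) :
  mu `<< @leb R n -> measurable A -> leb A = 0 -> mu A = 0.
Proof.
by move=> /null_content_dominatesP ac mA; exact: ac.
Qed.

Lemma leb_bigcup_gt0 (R : realType) (n : nat) (F : nat -> set (Rd R n.+1)) :
  (forall k, measurable (F k)) -> leb (\bigcup_k F k) != 0 ->
  exists k, (0 < leb (F k))%E.
Proof.
move=> mF; apply: contra_neqP => /forallNP F0.
apply/eqP; rewrite eq_le measure_ge0 andbT.
apply: le_trans (generalized_Boole_inequality (@leb R n) mF _) _.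
  exact: bigcupT_measurable.
rewrite eseries0 // => k _ _; apply/eqP; rewrite eq_le measure_ge0 andbT leNgt.
by apply/negP; exact: F0.
Qed.

(** One level set [F k] of positive volume is the yardstick: the sets where the density is at least
    [M], or positive and at most [m], would violate the ratio inequality against it if they were not
    null. *)
Lemma frame_density_bounds (R : realType) (n : nat)
    (mu : probability (Rd R n.+1) R) (nu : {measure set Rd R n.+1 -> \bar R}) :
  mu `<< @leb R n -> frame_measure mu nu ->
  exists M m : R, exists S : set (Rd R n.+1),
    [/\ 0 < M, 0 < m, measurable S, mu (~` S) = 0 &
     forall A : set (Rd R n.+1), measurable A ->
       (mu A <= M%:E * leb A)%E /\ (m%:E * leb (A `&` S) <= mu A)%E].
Proof.
move=> ac [A [B [A0 [B0 frame]]]].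
pose phi := density mu; pose S : set (Rd R n.+1) := phi @^-1` `]0, +oo[.
have mS : measurable S by exact: density_itv_measurable.
have muS : mu (~` S) = 0.
  rewrite -(density_nonpos_null ac); congr (mu _).
  apply/seteqP; split=> x; rewrite /S /= !in_itv /= andbT.
    by move/negP; rewrite -leNgt.
  by rewrite leNgt => /negP.
pose F k : set (Rd R n.+1) := phi @^-1` `[k.+1%:R^-1, k.+1%:R].
have mF k : measurable (F k) by exact: density_itv_measurable.
have FS : S `<=` \bigcup_k F k.
  move=> x; rewrite /S /= in_itv /= andbT => px.
  have [k] := ltr_add_invr px; rewrite add0r => kx.
  pose l := maxn k (Num.truncn (phi x)); exists l => //.
  rewrite /F /= in_itv /=; apply/andP; split.
    rewrite (le_trans _ (ltW kx)) // lef_pV2 ?posrE ?ltr0n // ler_nat ltnS.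
    exact: leq_maxl.
  rewrite (le_trans (ltW (truncnS_gt _))) // ler_nat ltnS; exact: leq_maxr.
(* If all were null, domination would give [mu S = 0], whereas [S] has full mass. *)
have [k Fk0] : exists k, (0 < leb (F k))%E.
  apply: leb_bigcup_gt0 => //; apply/negP => /eqP F0.
  have muS1 : mu S = 1%E.
    rewrite -[S]setCK probability_setC; last exact: measurableC.
    by rewrite [X in (_ - X)%E]muS sube0.
  have mU : measurable (\bigcup_j F j) by exact: bigcupT_measurable.
  have : (mu S <= mu (\bigcup_j F j))%E by rewrite le_measure ?inE.
  by rewrite muS1 (null_dominates_eq0 ac mU F0) lee_fin ler10.
have k0 : 0 < k.+1%:R :> R by rewrite ltr0n.
have ki0 : 0 < k.+1%:R^-1 :> R by rewrite invr_gt0.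
(* Chosen against [A * M <= B * (k + 1)] and [A / (k + 1) <= B * m]: adding 1 and halving make both
   fail. *)
pose M := B * k.+1%:R / A + 1; pose m := A / (B * k.+1%:R) / 2.
have M0 : 0 < M by rewrite addr_gt0 // divr_gt0 // mulr_gt0.
have m0 : 0 < m by rewrite !divr_gt0 // mulr_gt0.
have lebM : leb (phi @^-1` `[M, +oo[) = 0.
  apply/eqP; rewrite eq_le measure_ge0 andbT leNgt; apply/negP => h.
  have : A * M <= B * k.+1%:R.
    apply: (frame_density_ratio A0 B0 frame ac _ (mF k) M0 ki0 _ _ h Fk0).
    - exact: density_itv_measurable.
    - by move=> x; rewrite /= in_itv /= andbT.
    - by move=> x; rewrite /F /= in_itv.
  by apply/negP; rewrite -ltNge /M mulrDr mulrCA divff ?gt_eqF // !mulr1 ltrDl.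
have lebm : leb (phi @^-1` `]0, m]) = 0.
  apply/eqP; apply: contraT => h.
  (* The exhaustion supplies the positive lower bound on the density that the ratio inequality needs
     on its second set. *)
  have [||j j0] := @leb_bigcup_gt0 R n (fun j => phi @^-1` `[j.+1%:R^-1, m]).
  - by move=> j; exact: density_itv_measurable.
  - apply: contra_neqN h => /eqP U0.
    apply/eqP; rewrite eq_le measure_ge0 andbT -U0 le_measure ?inE //.
    + exact: density_itv_measurable.
    + by apply: bigcupT_measurable => j; exact: density_itv_measurable.
    move=> x; rewrite /= in_itv /= => /andP[px xm].
    have [j] := ltr_add_invr px; rewrite add0r => /ltW jx.
    by exists j => //; rewrite /= in_itv /= jx.
  have : A * k.+1%:R^-1 <= B * m.
    apply: (frame_density_ratio (c := j.+1%:R^-1) A0 B0 frame ac (mF k) _ ki0 _ _ _ Fk0 j0).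
    - exact: density_itv_measurable.
    - by rewrite invr_gt0 ltr0n.
    - by move=> x; rewrite /F /= in_itv /= => /andP[].
    - by move=> x; rewrite /= in_itv.
  rewrite leNgt => /negP[]; rewrite /m.
  have -> : B * (A / (B * k.+1%:R) / 2) = A * k.+1%:R^-1 / 2.
    by rewrite invfM !mulrA [B * A]mulrC mulfK // gt_eqF.
  by rewrite ltr_pdivrMr // mulr_natr mulr2n ltrDl mulr_gt0.
exists M, m, S; split=> // D mD; split.
- have mE : measurable (phi @^-1` `[M, +oo[ : set (Rd R n.+1)) by exact: density_itv_measurable.
  rewrite (measureDI mu mD mE) [X in (_ + X)%E](_ : _ = 0) ?adde0; last first.
    apply: (null_dominates_eq0 ac); first exact: measurableI.
    by apply/eqP; rewrite eq_le measure_ge0 andbT -lebM le_measure ?inE //; exact: measurableI.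
  have mDE : measurable (D `\` phi @^-1` `[M, +oo[) by exact: measurableD.
  apply: le_trans (density_le ac mDE M0 _) _.
    by move=> x [_]; rewrite /= in_itv /= andbT => /negP; rewrite -ltNge => /ltW.
  by rewrite lee_pmul2l ?lte_fin // le_measure ?inE //; exact: subDsetl.
- have mE : measurable (phi @^-1` `]0, m] : set (Rd R n.+1)) by exact: density_itv_measurable.
  have mDS : measurable (D `&` S) by exact: measurableI.
  rewrite (measureDI (@leb R n) mDS mE) [X in (_ + X)%E](_ : _ = 0) ?adde0; last first.
    by apply/eqP; rewrite eq_le measure_ge0 andbT -lebm le_measure ?inE //; exact: measurableI.
  have mDE : measurable (D `&` S `\` phi @^-1` `]0, m]) by exact: measurableD.
  apply: (@le_trans _ _ (mu (D `&` S `\` phi @^-1` `]0, m]))).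
    apply: density_ge ac mDE (ltW m0) _ => x [[_]]; rewrite /S /= !in_itv /= andbT => px.
    by rewrite px /= => /negP; rewrite -ltNge => /ltW.
  by rewrite le_measure ?inE // => x [[]].
Qed.

(** * Growth of the mass along the iterates of a similarity *)

Lemma bernoulli_le (R : realFieldType) (h : R) (n : nat) :
  0 <= h -> 1 + h * n%:R <= (1 + h) ^+ n.
Proof.
move=> h0; elim: n => [|n IH]; first by rewrite mulr0 addr0 expr0.
rewrite exprS; apply: le_trans (ler_wpM2l _ IH); last by rewrite addr_ge0.
rewrite -natr1; have := mulr_ge0 (mulr_ge0 h0 h0) (ler0n R n); nra.
Qed.

(** Otherwise [x / y = 1 + h] with [h > 0], and by Bernoulli its powers outgrow [C]. This discards
    the constants in both scaling bounds. *)
Lemma le_of_expr_le (R : archiRealFieldType) (x y C : R) :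
  0 < y -> (forall n, x ^+ n <= C * y ^+ n) -> x <= y.
Proof.
move=> y0 xy; rewrite leNgt; apply/negP => yx.
pose h := x / y - 1.
have h0 : 0 < h by rewrite subr_gt0 ltr_pdivlMr // mul1r.
pose n := (Num.truncn (C / h)).+1.
have := xy n; rewrite -ler_pdivrMr ?exprn_gt0 // -expr_div_n leNgt => /negP; apply.
have -> : x / y = 1 + h by rewrite /h addrC subrK.
apply: lt_le_trans (bernoulli_le n (ltW h0)).
rewrite (@lt_trans _ _ (h * n%:R)) //; last by rewrite ltrDr.
by rewrite mulrC -ltr_pdivrMr // truncnS_gt.
Qed.

Lemma similarity_iter (R : realType) (d : nat) (s : R)
    (f : 'cV[R]_d -> 'cV[R]_d) (n : nat) :
  similarity s f -> similarity (s ^+ n) (iter n f).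
Proof.
move=> sf; elim: n => [|n IH]; first exact: similarity_id.
by rewrite exprS; exact: similarity_comp sf IH.
Qed.

Lemma similarity_inj (R : realType) (d : nat) (s : R)
    (f : 'cV[R]_d -> 'cV[R]_d) : s != 0 -> similarity s f -> injective f.
Proof. by move=> s0 /(similarity_inv s0)[g [_ /can_inj]]. Qed.

Lemma preimage_image_inj (T U : Type) (f : T -> U) (A : set T) :
  injective f -> f @^-1` (f @` A) = A.
Proof.
move=> fI; apply/seteqP; split=> [x [y Ay /fI <-] //|x Ax]; by exists x.
Qed.

Lemma similarity_image_measurable (R : realType) (d : nat) (s : R)
    (f : 'cV[R]_d -> 'cV[R]_d) (A : set (Rd R d)) :
  s != 0 -> similarity s f -> measurable A -> measurable (f @` A : set (Rd R d)).
Proof.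
move=> s0 sf mA; have [g [sg fK gK]] := similarity_inv s0 sf.
rewrite (_ : f @` A = g @^-1` A).
  by rewrite -[X in measurable X]setTI; exact: similarity_measurable sg _ _ mA.
apply/seteqP; split=> [_ [x Ax <-]|y Agy]; first by rewrite /= fK.
by exists (g y) => //; rewrite gK.
Qed.

Lemma similarity_preimage_measurable (R : realType) (d : nat) (s : R)
    (f : 'cV[R]_d -> 'cV[R]_d) (A : set (Rd R d)) :
  similarity s f -> measurable A -> measurable (f @^-1` A : set (Rd R d)).
Proof.
move=> sf mA; rewrite -[X in measurable X]setTI.
exact: similarity_measurable sf _ _ mA.
Qed.

Lemma mu_iter_ge (R : realType) (d : nat) (mu : probability (Rd R d) R)
    (s p : R) (f : 'cV[R]_d -> 'cV[R]_d) :
  similarity s f -> 0 <= p ->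
  (forall A : set (Rd R d), measurable A -> (p%:E * mu (f @^-1` A) <= mu A)%E) ->
  forall n (A : set (Rd R d)), measurable A ->
  ((p ^+ n)%:E * mu (iter n f @^-1` A) <= mu A)%E.
Proof.
move=> sf p0 pf; elim=> [|n IH] A mA; first by rewrite mul1e.
apply: le_trans (IH _ mA); rewrite exprSr EFinM -muleA.
rewrite lee_wpmul2l ?lee_fin ?exprn_ge0 //.
have -> : iter n.+1 f @^-1` A = f @^-1` (iter n f @^-1` A).
  by apply/seteqP; split=> x; rewrite /preimage /= -iterSr.
apply: pf; exact: similarity_preimage_measurable (similarity_iter n sf) mA.
Qed.

Lemma fine_probability (R : realType) d (T : measurableType d)
    (mu : probability T R) (A : set T) : measurable A -> mu A = (fine (mu A))%:E.
Proof. by move=> mA; rewrite fineK // fin_num_measure. Qed.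

Lemma probability_bigcup_gt0 (R : realType) (d : nat) (mu : probability (Rd R d) R)
    (F : nat -> set (Rd R d)) : (forall j, measurable (F j)) ->
  \bigcup_j F j = setT -> exists j, (0 < mu (F j))%E.
Proof.
move=> mF FT; apply: contrapT => /forallNP F0.
have : (mu (\bigcup_j F j) <= \sum_(j <oo) mu (F j))%E.
  by apply: generalized_Boole_inequality => //; exact: bigcupT_measurable.
rewrite FT probability_setT eseries0 ?lee_fin ?ler10 // => j _ _.
by apply/eqP; rewrite eq_le measure_ge0 andbT leNgt; apply/negP; exact: F0.
Qed.

Lemma scaling_upper (R : realType) (n : nat) (mu : probability (Rd R n.+1) R)
    (s p M : R) (f : 'cV[R]_n.+1 -> 'cV[R]_n.+1) :
  0 < s -> similarity s f -> 0 <= p -> 0 < M ->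
  (forall A : set (Rd R n.+1), measurable A ->
     (p%:E * mu (f @^-1` A) <= mu A)%E) ->
  (forall A : set (Rd R n.+1), measurable A -> (mu A <= M%:E * leb A)%E) ->
  p <= s ^+ n.+1.
Proof.
move=> s0 sf p0 M0 pf muM.
pose Q j : set (Rd R n.+1) := box (const_mx (- j%:R)) (const_mx j%:R).
have mQ j : measurable (Q j) by exact: (@closed_measurable_Rd R n.+1 _ (@closed_box R n.+1 _ _)).
have [j Qj] := probability_bigcup_gt0 mu mQ (bigcup_box R n.+1).
have Qfin : leb (Q j) \is a fin_num.
  by rewrite ge0_fin_numE ?measure_ge0 //; exact: leb_box_lty.
(* Collects everything that does not depend on the number [l] of iterations. *)
pose C := M * (2 * n.+1%:R) ^+ n.+1 * fine (leb (Q j)) / fine (mu (Q j)).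
apply: (@le_of_expr_le _ _ _ C); first exact: exprn_gt0.
move=> l; have sl := similarity_iter l sf.
have sl0 : 0 < s ^+ l by exact: exprn_gt0.
have slN0 := lt0r_neq0 sl0.
have mfQ : measurable (iter l f @` Q j : set (Rd R n.+1)).
  exact: similarity_image_measurable slN0 sl (mQ j).
have := mu_iter_ge sf p0 pf l mfQ.
rewrite preimage_image_inj; last exact: similarity_inj slN0 sl.
move=> /le_trans/(_ (muM _ mfQ))/le_trans h.
have {h} := h _ (lee_wpmul2l _ (leb_similarity (Q j) sl0 sl)).
rewrite lee_fin => /(_ (ltW M0)).
rewrite (fine_probability mu (mQ j)) -(fineK Qfin) -!EFinM lee_fin.
have q0 : 0 < fine (mu (Q j)) by rewrite -lte_fin -fine_probability.
rewrite -ler_pdivlMr // => /le_trans; apply.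
rewrite le_eqVlt; apply/orP; left; apply/eqP.
rewrite /C -exprM [(n.+1 * l)%N]mulnC exprM.
have -> : (2 * s ^+ l * n.+1%:R) ^+ n.+1 = (2 * n.+1%:R) ^+ n.+1 * (s ^+ l) ^+ n.+1.
  by rewrite -exprMn; congr (_ ^+ _); ring.
by ring.
Qed.

Lemma normsq_sub_measurable (R : realType) (d : nat) (x0 : 'cV[R]_d) :
  measurable_fun setT ((fun x => normsq (x - x0)) : Rd R d -> R).
Proof.
apply: measurable_sum => i; apply: measurable_funX.
rewrite (_ : (fun _ => _) = fun x : Rd R d => (x : 'cV[R]_d) i 0 - x0 i 0).
  by apply: measurable_funB => //; exact: measurable_coord.
by apply/funext => x; rewrite !mxE.
Qed.

Lemma exists_expr_lt (R : archiRealFieldType) (z D e : R) :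
  0 < z -> z < 1 -> 0 < e -> exists n, z ^+ n * D < e.
Proof.
move=> z0 z1 e0; apply: contrapT => /forallNP h.
have : 1 <= z.
  apply: (@le_of_expr_le _ _ _ (D / e)) => // n; rewrite expr1n.
  have /negP := h n; rewrite -leNgt => h'.
  by rewrite mulrAC ler_pdivlMr // mul1r mulrC.
by rewrite leNgt z1.
Qed.

(** Volume is needed from below, so the rough estimate is applied to the inverse of the iterate, of
    ratio [s^-l], which takes the image of [A] back to [A]; the upper density bound keeps [leb A]
    away from 0. *)
Lemma scaling_lower (R : realType) (n : nat) (mu : probability (Rd R n.+1) R)
    (s p M m e : R) (f : 'cV[R]_n.+1 -> 'cV[R]_n.+1) (x0 : 'cV[R]_n.+1)
    (S : set (Rd R n.+1)) :
  0 < s < 1 -> similarity s f -> 0 < p -> 0 < M -> 0 < m -> f x0 = x0 -> 0 < e ->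
  (forall A : set (Rd R n.+1), measurable A ->
     (p%:E * mu (f @^-1` A) <= mu A)%E) ->
  (forall A : set (Rd R n.+1), measurable A ->
     A `<=` [set x | normsq (x - x0) < e] -> mu A = (p%:E * mu (f @^-1` A))%E) ->
  measurable S -> mu (~` S) = 0 ->
  (forall A : set (Rd R n.+1), measurable A ->
       (mu A <= M%:E * leb A)%E /\ (m%:E * leb (A `&` S) <= mu A)%E) ->
  s ^+ n.+1 <= p.
Proof.
move=> /andP[s0 s1] sf p0 M0 m0 fx0 e0 pf eqf mS muS bnd.
pose B : set (Rd R n.+1) := [set x | normsq (x - x0) < e].
have mB : measurable B.
  rewrite (_ : B = setT `&` (fun x => normsq (x - x0)) @^-1` `]-oo, e[).
    by apply: normsq_sub_measurable => //; exact: measurable_itv.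
  by rewrite setTI; apply/seteqP; split=> x; rewrite /= in_itv.
have s21 : s ^+ 2 < 1 by rewrite expr_lt1 // ltW.
have fB x : B x -> B (f x).
  rewrite /B /= -{2}fx0 (similarity_normsq _ _ sf); apply: le_lt_trans.
  by rewrite ler_piMl ?(ltW s21) // sumr_ge0 // => i _; exact: sqr_ge0.
have iterx0 l : iter l f x0 = x0 by elim: l => //= l ->.
(* Preimages of the ball under the iterates exhaust the space, so one of them has mass, and [mu B]
   is at least [p^j] times that mass. *)
have muB : (0 < mu B)%E.
  have mfB j : measurable (iter j f @^-1` B : set (Rd R n.+1)).
    exact: similarity_preimage_measurable (similarity_iter j sf) mB.
  have [|j] := probability_bigcup_gt0 mu mfB.
    apply/seteqP; split=> // x _.
    have [j ej] := exists_expr_lt (normsq (x - x0)) (exprn_gt0 2 s0) s21 e0.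
    exists j => //; rewrite /B /= -(iterx0 j).
    by rewrite (similarity_normsq _ _ (similarity_iter j sf)) exprAC.
  move=> mufB; apply: lt_le_trans (mu_iter_ge sf (ltW p0) pf j mB).
  by rewrite mule_gt0 // lte_fin exprn_gt0.
have muimg (A : set (Rd R n.+1)) : measurable A -> A `<=` B -> forall l,
    [/\ measurable (iter l f @` A : set (Rd R n.+1)), iter l f @` A `<=` B &
     mu (iter l f @` A) = ((p ^+ l)%:E * mu A)%E].
  move=> mA AB; elim=> [|l [mfA fAB muA]].
    by rewrite mul1e (_ : iter 0 f @` A = A) // image_id.
  have E : iter l.+1 f @` A = f @` (iter l f @` A) by rewrite -image_comp.
  have mfA' : measurable (f @` (iter l f @` A) : set (Rd R n.+1)).
    exact: similarity_image_measurable (lt0r_neq0 s0) sf mfA.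
  have sub : f @` (iter l f @` A) `<=` B by move=> _ [x /fAB/fB + <-].
  rewrite E; split=> //; rewrite (eqf _ mfA' sub) preimage_image_inj.
    by rewrite muA exprS EFinM muleA.
  exact: similarity_inj (lt0r_neq0 s0) sf.
pose C := M * (2 * n.+1%:R) ^+ n.+1 / m.
apply: (@le_of_expr_le _ _ _ C) => // l; have sl := similarity_iter l sf.
have sl0 : 0 < s ^+ l by exact: exprn_gt0.
have slN0 := lt0r_neq0 sl0.
have [g [sg fK gK]] := similarity_inv slN0 sl.
(* Shrunk so that its image is the part of the image of [B] inside [S], where the lower density
   bound holds. *)
pose A : set (Rd R n.+1) := B `&` iter l f @^-1` S.
have mA : measurable A.
  by apply: measurableI => //; exact: similarity_preimage_measurable sl mS.
have [mfB _ mufB] := muimg B mB (@subset_refl _ _) l.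
have [mfA _ mufA] := muimg A mA (@subIsetl _ _ _) l.
have fAE : iter l f @` A = iter l f @` B `&` S.
  apply/seteqP; split=> [_ [x [Bx Sx] <-]|_ [[x Bx <-] Sx]]; first by split=> //; exists x.
  by exists x.
have fAB : mu (iter l f @` A) = mu (iter l f @` B).
  rewrite [RHS](measureDI mu mfB mS) fAE [X in (X + _)%E](_ : _ = 0) ?add0e //.
  apply/eqP; rewrite eq_le measure_ge0 andbT -muS le_measure ?inE //.
  - exact: measurableD.
  - exact: measurableC.
(* The images have equal mass because [S] has full mass, and each is [p^l] times the original. *)
have muAB : mu A = mu B.
  have pl0 : 0 < p ^+ l by exact: exprn_gt0.
  move: fAB; rewrite mufA mufB (fine_probability mu mA) (fine_probability mu mB).
  by rewrite -!EFinM => -[/(mulfI (lt0r_neq0 pl0)) ->].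
have [_] := bnd _ mfA; rewrite (_ : _ `&` S = iter l f @` A); last first.
  by rewrite fAE -setIA setIid.
set L := leb _; rewrite mufA muAB (fine_probability mu mB) => mL.
have q0 : 0 < fine (mu B) by rewrite -lte_fin -fine_probability.
have Lfin : L \is a fin_num.
  rewrite ge0_fin_numE ?measure_ge0 // -(@lte_pmul2l _ m%:E) ?lte_fin //.
  by rewrite gt0_muley ?lte_fin // (le_lt_trans mL) // -EFinM ltry.
have [hi _] := bnd _ mA.
have sl'0 : 0 < (s ^+ l)^-1 by rewrite invr_gt0.
have := leb_similarity (iter l f @` A) sl'0 sg.
rewrite (_ : g @` _ = A); last first.
  by rewrite image_comp (_ : g \o _ = id) ?image_id //; apply/funext => x /=; rewrite fK.
move=> lebA; have {hi lebA} := le_trans hi (lee_wpmul2l _ lebA).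
rewrite lee_fin => /(_ (ltW M0)).
rewrite muAB (fine_probability mu mB).
move: mL; rewrite -/L -(fineK Lfin) -!EFinM !lee_fin => mL hi.
set q := fine (mu B) in mL hi q0; set y := fine L in mL hi.
have y0 : 0 <= y by rewrite fine_ge0 // measure_ge0.
have sln0 : 0 < (s ^+ l) ^+ n.+1 by exact: exprn_gt0.
have hi' : q * (s ^+ l) ^+ n.+1 <= M * ((2 * n.+1%:R) ^+ n.+1 * y).
  rewrite -ler_pdivlMr //; apply: le_trans hi _.
  rewrite le_eqVlt; apply/orP; left; apply/eqP.
  have -> : (2 * (s ^+ l)^-1 * n.+1%:R) ^+ n.+1 =
      (2 * n.+1%:R) ^+ n.+1 * ((s ^+ l) ^+ n.+1)^-1.
    by rewrite -[X in _ = _ * X]exprVn -exprMn; congr (_ ^+ _); ring.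
  by ring.
have yle : y <= p ^+ l * q / m by rewrite ler_pdivlMr // mulrC.
rewrite -exprM mulnC exprM -(ler_pM2l q0); apply: (le_trans hi').
rewrite (_ : q * _ = M * ((2 * n.+1%:R) ^+ n.+1 * (p ^+ l * q / m))); last first.
  by rewrite /C; ring.
by rewrite ler_wpM2l ?(ltW M0) // ler_wpM2l // exprn_ge0 // mulr_ge0.
Qed.

(** * Words *)

Lemma tau_word_similarity (R : realType) (d N k : nat) (lam : R) (O : 'M[R]_d)
    (b : 'I_N -> 'cV[R]_d) (I : {ffun 'I_k -> 'I_N}) :
  O^T *m O = 1%:M -> similarity (lam ^+ k) (tau_word lam O b I).
Proof.
move=> OO; rewrite /tau_word -[X in _ ^+ X](size_enum_ord k).
elim: (enum 'I_k) => [|j s IH] /=; first exact: similarity_id.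
by rewrite exprS; apply: similarity_comp => //; exact: similarity_tau.
Qed.

Definition consf (N k : nat) (iJ : 'I_N * {ffun 'I_k -> 'I_N}) :
    {ffun 'I_k.+1 -> 'I_N} :=
  [ffun j => if unlift ord0 j is Some j' then iJ.2 j' else iJ.1].

Lemma consf_bij (N k : nat) : bijective (@consf N k).
Proof.
exists (fun J : {ffun 'I_k.+1 -> 'I_N} => (J ord0, [ffun j => J (lift ord0 j)])) => [[i J]|J].
  congr pair; first by rewrite ffunE unlift_none.
  by apply/ffunP => j; rewrite !ffunE liftK.
apply/ffunP => j; rewrite ffunE /=; case: unliftP => [j'|] -> //.
by rewrite ffunE.
Qed.

Lemma tau_word_consf (R : realType) (d N k : nat) (lam : R) (O : 'M[R]_d)
    (b : 'I_N -> 'cV[R]_d) (i : 'I_N) (J : {ffun 'I_k -> 'I_N}) :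
  tau_word lam O b (consf (i, J)) = tau lam O (b i) \o tau_word lam O b J.
Proof.
rewrite /tau_word enum_ordSl /= ffunE unlift_none; congr (_ \o _).
elim: (enum 'I_k) => //= j s ->.
by rewrite ffunE liftK.
Qed.

Lemma p_word_consf (R : realType) (N k : nat) (p : 'I_N -> R) (i : 'I_N)
    (J : {ffun 'I_k -> 'I_N}) : p_word p (consf (i, J)) = p i * p_word p J.
Proof.
rewrite /p_word big_ord_recl ffunE unlift_none; congr (_ * _).
by apply: eq_bigr => j _; rewrite ffunE liftK.
Qed.

Lemma p_word_gt0 (R : realType) (N k : nat) (p : 'I_N -> R)
    (J : {ffun 'I_k -> 'I_N}) : (forall i, 0 < p i) -> 0 < p_word p J.
Proof. by move=> p0; apply: prodr_gt0 => j _. Qed.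

Lemma sum_p_word (R : realType) (N k : nat) (p : 'I_N -> R) :
  \sum_i p i = 1 -> \sum_(J : {ffun 'I_k -> 'I_N}) p_word p J = 1.
Proof.
move=> p1; rewrite -(bigA_distr_bigA (fun (_ : 'I_k) i => p i)) big1 // => j _.
Qed.

Lemma p_tau_gt0 (R : realType) (d N k : nat) (lam : R) (O : 'M[R]_d)
    (b : 'I_N -> 'cV[R]_d) (p : 'I_N -> R) (I : {ffun 'I_k -> 'I_N}) :
  (forall i, 0 < p i) -> 0 < p_tau lam O b p I.
Proof.
move=> p0; rewrite /p_tau (bigD1 I) /=; last exact/asboolP.
by rewrite ltr_pwDl ?p_word_gt0 // sumr_ge0 // => J _; exact/ltW/p_word_gt0.
Qed.

(** Settles the degenerate cases, dimension 0 and the empty word, where all words give the same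
    map. *)
Lemma p_tau_eq1 (R : realType) (d N k : nat) (lam : R) (O : 'M[R]_d)
    (b : 'I_N -> 'cV[R]_d) (p : 'I_N -> R) (I : {ffun 'I_k -> 'I_N}) :
  \sum_i p i = 1 -> (forall J : {ffun 'I_k -> 'I_N}, tau_word lam O b J = tau_word lam O b I) ->
  p_tau lam O b p I = 1.
Proof.
move=> p1 JI; rewrite /p_tau -(sum_p_word k p1).
by apply: eq_bigl => J; exact/asboolP.
Qed.

Section self_similar_measure.
Context (R : realType) (d N : nat) (lam : R) (O : 'M[R]_d)
  (b : 'I_N -> 'cV[R]_d) (p : 'I_N -> R) (mu : probability (Rd R d) R).
Hypothesis OO : O^T *m O = 1%:M.
Hypothesis p0 : forall i, 0 < p i.
Hypothesis mu_inv : forall A : set (Rd R d), measurable A ->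
  mu A = (\sum_(i < N) (p i)%:E * mu (tau lam O (b i) @^-1` A))%E.

(** The first letter is the outermost map, so invariance is applied to [A] and the induction
    hypothesis to its preimage under that letter. *)
Lemma word_invariance (k : nat) (A : set (Rd R d)) : measurable A ->
  mu A = (\sum_(J : {ffun 'I_k -> 'I_N})
            (p_word p J)%:E * mu (tau_word lam O b J @^-1` A))%E.
Proof.
elim: k A => [|k IH] A mA.
  pose J0 : {ffun 'I_0 -> 'I_N} := ffun0 (card_ord 0).
  have E (J : {ffun 'I_0 -> 'I_N}) : J = J0 by apply/ffunP => -[].
  rewrite (bigD1 J0) //=.
  rewrite big1 ?adde0; last by move=> J; rewrite (E J) eqxx.
  by rewrite /p_word big_ord0 mul1e /tau_word enum_ord0.
rewrite (reindex (@consf N k)); last exact/onW_bij/consf_bij.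
rewrite (mu_inv mA) (eq_bigr (fun i => \sum_(J : {ffun 'I_k -> 'I_N})
  ((p_word p (consf (i, J)))%:E * mu (tau_word lam O b (consf (i, J)) @^-1` A))%E)%E).
  by rewrite pair_big /=; apply: eq_bigr => -[i J].
move=> i _; rewrite IH; last first.
  by apply: similarity_preimage_measurable mA; exact: similarity_tau OO.
rewrite ge0_sume_distrr; last first.
  by move=> J _; rewrite mule_ge0 // lee_fin ltW // p_word_gt0.
apply: eq_bigr => J _; rewrite p_word_consf EFinM -muleA tau_word_consf.
by [].
Qed.

Lemma p_tau_measure_le (k : nat) (I : {ffun 'I_k -> 'I_N}) (A : set (Rd R d)) :
  measurable A ->
  ((p_tau lam O b p I)%:E * mu (tau_word lam O b I @^-1` A) <= mu A)%E.
Proof.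
move=> mA; rewrite (word_invariance k mA) /p_tau.
rewrite [leRHS](bigID (fun J => `[< tau_word lam O b J = tau_word lam O b I >])) /=.
rewrite -[leLHS]adde0 leeD //; last first.
  by apply: sume_ge0 => J _; rewrite mule_ge0 // lee_fin ltW // p_word_gt0.
rewrite -sumEFin ge0_sume_distrl; last by move=> J _; rewrite lee_fin ltW // p_word_gt0.
by apply: lee_sum => J /asboolP ->.
Qed.

Lemma p_tau_measure_eq (k : nat) (I : {ffun 'I_k -> 'I_N}) (A : set (Rd R d)) :
  measurable A ->
  (forall J : {ffun 'I_k -> 'I_N}, tau_word lam O b J <> tau_word lam O b I ->
     mu (tau_word lam O b J @^-1` A) = 0) ->
  mu A = ((p_tau lam O b p I)%:E * mu (tau_word lam O b I @^-1` A))%E.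
Proof.
move=> mA JI; rewrite (word_invariance k mA) /p_tau.
rewrite [LHS](bigID (fun J => `[< tau_word lam O b J = tau_word lam O b I >])) /=.
rewrite [X in (_ + X)%E]big1 ?adde0; last by move=> J /asboolPn/JI ->; rewrite mule0.
rewrite -sumEFin ge0_sume_distrl; last by move=> J _; rewrite lee_fin ltW // p_word_gt0.
by apply: eq_bigr => J /asboolP ->.
Qed.

End self_similar_measure.

(** * Fixed points and separation from the other pieces *)

Lemma normsq_eq0 (R : realType) (d : nat) (x : 'cV[R]_d) : normsq x = 0 -> x = 0.
Proof.
move=> x0; apply/matrixP => i j; rewrite (ord1 j) [RHS]mxE.
apply/eqP; rewrite -sqrf_eq0 eq_le sqr_ge0 andbT -x0; exact: coord_normsq.
Qed.

(** The fixed point solves a linear system with matrix [1 - s U], invertible because [s U] strictly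
    shrinks Euclidean length. *)
Lemma similarity_fixpoint (R : realType) (d : nat) (s : R)
    (f : 'cV[R]_d -> 'cV[R]_d) : 0 < s < 1 -> similarity s f ->
  exists x, f x = x.
Proof.
move=> /andP[s0 s1] [U [c UU fE]].
have UU' : U^T^T *m U^T = 1%:M by rewrite trmxK; exact: mulmx1C.
pose M := 1%:M - s *: U.
have uM : M \in unitmx.
  rewrite -row_free_unit; apply: inj_row_free => v /eqP.
  rewrite /M mulmxBr mulmx1 subr_eq0 => /eqP vE.
  (* The kernel vector is a row, so its transpose is a fixed point of [s U^T], again a similarity of
     ratio [s]. *)
  pose g (x : 'cV[R]_d) : 'cV[R]_d := s *: (U^T *m x) + 0.
  have sg : similarity s g by exists U^T, 0.
  have gv : g v^T = v^T.
    by rewrite /g addr0 {2}vE -trmx_mul -scalemxAr linearZ.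
  have g0 : g 0 = 0 by rewrite /g mulmx0 scaler0 addr0.
  have := similarity_normsq v^T 0 sg; rewrite gv g0 subr0 => /eqP.
  rewrite -subr_eq0 -{1}[normsq _]mul1r -mulrBl mulf_eq0 subr_eq0.
  have -> : (1 == s ^+ 2) = false by rewrite gt_eqF // expr_lt1 // ltW.
  move=> /eqP/normsq_eq0/(congr1 trmx).
  by rewrite trmxK trmx0.
exists (invmx M *m c); rewrite fE; apply/esym/eqP; rewrite addrC -subr_eq.
have -> (y : 'cV[R]_d) : y - s *: (U *m y) = M *m y.
  by rewrite /M mulmxBl mul1mx scalemxAl.
by rewrite mulmxA mulmxV // mul1mx.
Qed.

(** Pulled back by the inverse, [x] falls outside the closed [X], hence at some distance [r] from
    it; [f] multiplies squared distances by [s^2]. *)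
Lemma similarity_image_avoid (R : realType) (d : nat) (s : R)
    (f : 'cV[R]_d -> 'cV[R]_d) (X : set 'cV[R]_d) (x : 'cV[R]_d) :
  0 < s -> similarity s f -> closed X -> ~ (f @` X) x ->
  exists2 e, 0 < e & forall y, X y -> e <= normsq (f y - x).
Proof.
move=> s0 sf cX fXx; have [g [sg fK gK]] := similarity_inv (lt0r_neq0 s0) sf.
have Xgx : (~` X) (g x) by move=> Xgx; apply: fXx; exists (g x).
have /nbhs_ballP[r /= r0 rX] : nbhs (g x) (~` X).
  by apply: open_nbhs_nbhs; split=> //; exact: closed_openC.
exists (s ^+ 2 * r ^+ 2) => [|y Xy]; first by rewrite mulr_gt0 ?exprn_gt0.
rewrite -{1}(gK x) (similarity_normsq _ _ sf) ler_pM2l ?exprn_gt0 // leNgt.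
apply/negP => yr; apply: (rX y) => //; split=> // i j; rewrite (ord1 j) /ball /=.
rewrite distrC -(@ltr_pXn2r _ 2) ?nnegrE ?(ltW r0) // real_normK ?num_real //.
apply: le_lt_trans yr; have := coord_normsq (y - g x) i.
by rewrite !mxE.
Qed.

Lemma finite_pos_lbound (R : realType) (T : finType) (e : T -> R) :
  (forall t, 0 < e t) -> exists2 c, 0 < c & forall t, c <= e t.
Proof.
move=> e0; exists (\big[Num.min/1]_t e t).
  by elim/big_rec: _ => // t x _ x0; rewrite lt_min e0.
by move=> t; exact: bigmin_le_cond.
Qed.

Theorem theorem3p10 (R : realType) (d N : nat)
  (lam : R) (O : 'M[R]_d) (b : 'I_N -> 'cV[R]_d) (p : 'I_N -> R)
  (X : set 'cV[R]_d) (mu : probability (Rd R d) R) :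
  0 < lam < 1 ->
  O^T *m O = 1%:M ->
  (forall i, 0 < p i) ->
  \sum_(i < N) p i = 1 ->
  (* X is the attractor: the nonempty compact set with X = U_i tau_{b_i}(X) *)
  X !=set0 -> compact X ->
  X = \bigcup_(i in [set: 'I_N]) (tau lam O (b i) @` X) ->
  (* mu is the invariant (self-similar) probability measure *)
  (forall A : set (Rd R d), measurable A ->
     mu A = (\sum_(i < N) (p i)%:E * mu (tau lam O (b i) @^-1` A))%E) ->
  (* mu is absolutely continuous w.r.t. Lebesgue measure restricted to X *)
  (forall A : set (Rd R d), measurable A -> leb_null (A `&` X) -> mu A = 0%E) ->
  (* mu admits a frame measure *)
  (exists nu : {measure set Rd R d -> \bar R}, frame_measure mu nu) ->
  (forall (k : nat) (I : {ffun 'I_k -> 'I_N}),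
     p_tau lam O b p I <= lam ^+ (d * k)) /\
  (forall (k : nat) (I : {ffun 'I_k -> 'I_N}),
     fixed_point_condition lam O b X I ->
     p_tau lam O b p I = lam ^+ (d * k)).
Proof.
move=> /andP[lam0 lam1] OO p0 p1 _ cptX _ mu_inv mu_ac [nu frame].
(* In dimension 0 there is only one map, and both sides equal 1. *)
case: d O b X mu OO cptX mu_inv mu_ac nu frame => [|n] O b X mu OO cptX mu_inv mu_ac nu frame.
  have triv k (I : {ffun 'I_k -> 'I_N}) : p_tau lam O b p I = 1.
    apply: p_tau_eq1 => // J; apply/funext => x.
    by rewrite [LHS]flatmx0 [RHS]flatmx0.
  by split=> k I => [|_]; rewrite triv mul0n expr0.
have ac : mu `<< @leb R n.
  apply/null_content_dominatesP => A mA A0; apply: mu_ac => //.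
  apply: leb_null_leb0; apply/eqP; rewrite eq_le measure_ge0 andbT -A0.
  exact: (le_outer_measure (@leb_outer R n) _ _ (@subIsetl _ _ _)).
have [M [m [S [M0 m0 mS muS bnd]]]] := frame_density_bounds ac frame.
have sim k (I : {ffun 'I_k -> 'I_N}) := tau_word_similarity lam b I OO.
have ub k (I : {ffun 'I_k -> 'I_N}) : p_tau lam O b p I <= lam ^+ (n.+1 * k).
  rewrite mulnC exprM; apply: (scaling_upper (M := M) _ (sim k I)) => //.
  - exact: exprn_gt0.
  - exact/ltW/p_tau_gt0.
  - by move=> A mA; exact: (p_tau_measure_le OO p0 mu_inv I mA).
  - by move=> A mA; have [] := bnd A mA.
(* The empty word has ratio 1 and is not a contraction, so it is treated apart. *)
split=> // k I fpc; have [k0|k0] := posnP k.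
  rewrite k0 in I fpc *; rewrite muln0 expr0; apply: p_tau_eq1 => // J.
  by rewrite /tau_word enum_ord0.
apply/eqP; rewrite eq_le ub /=.
have s01 : 0 < lam ^+ k < 1 by rewrite exprn_gt0 // exprn_ilt1 ?ltW // -lt0n k0.
have /andP[s0 _] := s01.
have [x0 fx0] := similarity_fixpoint s01 (sim k I).
have cX : closed X by exact: compact_closed (@norm_hausdorff _ _) cptX.
have muX : mu (~` X) = 0.
  apply: mu_ac; first by apply: measurableC; exact: closed_measurable_Rd.
  by rewrite setICl; apply: leb_null_leb0; exact: measure0.
(* Words with the same map as [I] impose no condition; any positive value, here 1, does for them. *)
have /choice[e eP] (J : {ffun 'I_k -> 'I_N}) : exists e, 0 < e /\
    (tau_word lam O b J <> tau_word lam O b I ->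
     forall y, X y -> e <= normsq (tau_word lam O b J y - x0)).
  have [JI|JI] := pselect (tau_word lam O b J = tau_word lam O b I).
    by exists 1; split=> // /(_ JI).
  by have [e e0 eX] := similarity_image_avoid s0 (sim k J) cX (fpc x0 fx0 J JI); exists e.
have [c c0 ce] := finite_pos_lbound (fun J => (eP J).1).
rewrite mulnC exprM.
apply: (scaling_lower s01 (sim k I) _ M0 m0 fx0 c0 _ _ mS muS bnd).
- exact: p_tau_gt0.
- by move=> A mA; exact: (p_tau_measure_le OO p0 mu_inv I mA).
(* Near [x0] the other maps do not reach from [X]: their preimages of [A] lie in the complement of
   [X], which is [mu]-null. *)
- move=> A mA AB; apply: (p_tau_measure_eq OO p0 mu_inv) => // J JI.
  apply/eqP; rewrite eq_le measure_ge0 andbT -muX le_measure ?inE //.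
  + exact: similarity_preimage_measurable (sim k J) mA.
  + by apply: measurableC; exact: closed_measurable_Rd.
  move=> y /AB /= yc Xy; have := (eP J).2 JI y Xy.
  by rewrite leNgt (lt_le_trans yc).
Qed.
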